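(* Any one-orbit Lie groupoid is transitive. That is, if $\Gamma\rightrightarrows X$ is a Lie groupoid whose combined source–target map $(s,t):\Gamma\to X\times X$ is surjective, then this map is a surjective submersion.
   Context: A smooth manifold is a non-empty $C^\infty$ manifold of constant dimension whose topology is Hausdorff and second countable. A Lie groupoid $\Gamma\rightrightarrows X$ is a groupoid whose set of objects $X$ (its base) and set of arrows (also written $\Gamma$) are smooth manifolds, with source $s$ and target $t$ submersive $C^\infty$ maps and composition, unit and inverse maps of class $C^\infty$. A one-orbit groupoid is a groupoid whose map $(s,t)$ is surjective. A Lie groupoid is transitive if $(s,t):\Gamma\to X\times X$ is a surjective submersion. *)

(* Defs.v *)
(* The real numbers are an arbitrary R : realType and R^n is 'rV[R]_n, n = 0
   included. *)
From HB Require Import structures.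
From mathcomp Require Import all_boot all_order all_algebra.
From mathcomp Require Import all_classical all_reals all_analysis.

Set Implicit Arguments.
Unset Strict Implicit.
Unset Printing Implicit Defensive.

Import Order.TTheory GRing.Theory Num.Theory numFieldNormedType.Exports.

Local Open Scope classical_set_scope.
Local Open Scope ring_scope.

(* Maps between Euclidean spaces are total functions, of which only the values
   on an open set U matter.  In finite dimension f is C^(k+1) on U iff it is
   differentiable on U and all its directional derivatives are C^k on U. *)
Fixpoint Ck {R : realType} (k : nat) {m n : nat} (U : set 'rV[R]_m)
    (f : 'rV[R]_m -> 'rV[R]_n) : Prop :=
  match k with
  | 0%N => {in U, continuous f}
  | k'.+1 => {in U, forall x, differentiable f x} /\
             forall v : 'rV[R]_m, Ck k' U (fun x => 'D_v f x)
  end.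

Definition smooth_on {R : realType} {m n : nat} (U : set 'rV[R]_m)
  (f : 'rV[R]_m -> 'rV[R]_n) : Prop := forall k, Ck k U f.

(* A homeomorphism cmap from the open set cdom onto an open subset of R^n, with
   inverse cinv; the values of cmap and cinv outside these sets are junk. *)
Record chart (R : realType) (T : topologicalType) (n : nat) := Chart {
  cdom : set T;
  cmap : T -> 'rV[R]_n;
  cinv : 'rV[R]_n -> T;
  cdom_open : open cdom;
  cimg_open : open (cmap @` cdom);
  cmapK : {in cdom, cancel cmap cinv};
  cmap_continuous : {in cdom, continuous cmap};
  cinv_continuous : {in cmap @` cdom, continuous cinv}
}.

Definition smooth_transition {R : realType} {T : topologicalType} {n : nat}
    (c d : chart R T n) : Prop :=
  smooth_on (cmap c @` (cdom c `&` cdom d)) (cmap d \o cinv c).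

(* The smooth structure is given by an atlas, not required to be maximal. *)
Record manifold (R : realType) := Manifold {
  carrier :> topologicalType;
  mdim : nat;
  atlas : set (chart R carrier mdim);
  manifold_nonempty : [set: carrier] !=set0;
  manifold_hausdorff : hausdorff_space carrier;
  manifold_second_countable : @second_countable carrier;
  atlas_cover : forall x, exists2 c, atlas c & cdom c x;
  atlas_compatible : forall c d, atlas c -> atlas d -> smooth_transition c d
}.

Definition local_rep {R : realType} {M N : topologicalType} {m n : nat}
    (c : chart R M m) (d : chart R N n) (f : M -> N) : 'rV[R]_m -> 'rV[R]_n :=
  cmap d \o f \o cinv c.

Definition smooth_map {R : realType} {M N : manifold R} (f : M -> N) : Prop :=
  continuous f /\
  forall c d, atlas (m := M) c -> atlas (m := N) d ->
    smooth_on (cmap c @` (cdom c `&` f @^-1` cdom d)) (local_rep c d f).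

(* A smooth map all of whose tangent maps are surjective: in charts, the tangent
   map at x is the differential of the local representative. *)
Definition submersion {R : realType} {M N : manifold R} (f : M -> N) : Prop :=
  smooth_map f /\
  forall c d, atlas (m := M) c -> atlas (m := N) d ->
    forall x, cdom c x -> cdom d (f x) ->
    set_surj setT setT ('d (local_rep c d f) (cmap c x)).

Section ProductManifold.
Variable R : realType.

Lemma near_eq_continuous (S T : topologicalType) (f g : S -> T) (x : S) :
  {near x, f =1 g} -> {for x, continuous f} -> {for x, continuous g}.
Proof.
move=> fg fc; have fgx : f x = g x by apply: (nbhs_singleton fg).
rewrite /prop_for /continuous_at -fgx; exact: cvg_trans (near_eq_cvg fg) fc.
Qed.

Lemma near_eq_differentiable (V W : normedModType R) (f g : V -> W) (x : V) :
  {near x, f =1 g} -> differentiable f x -> differentiable g x.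
Proof.
move=> fg df; have -> : g = f + (g - f) by rewrite addrC subrK.
apply: differentiableD => //; apply/diffP => /=.
apply: (@getPex _ (fun (dg : {linear V -> W}) => continuous dg /\
  forall y, (g - f) y = (g - f) (lim (nbhs x)) + dg (y - lim (nbhs x))
                  +o_(y \near x) (y - lim (nbhs x)))).
exists (\0 : {linear V -> W}); split; first by move=> y; exact: cvg_cst.
suff H : g - f = cst ((g - f) (lim (nbhs x))) + \0
    +o_x (center (lim (nbhs x))).
  by apply: eqaddoEx => y; rewrite {1}H.
apply/eqaddoP => _/posnumP[e].
have fgx : f x = g x by apply: (nbhs_singleton fg).
near=> y; have fgy : f y = g y by near: y.
by rewrite lim_id // !fctE /= fgx fgy !subrr addr0 subr0 normr0 mulr_ge0.
Unshelve. all: by end_near. Qed.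

Lemma row_mx_continuous (T : topologicalType) m n (f : T -> 'rV[R]_m)
    (g : T -> 'rV[R]_n) (x : T) :
  {for x, continuous f} -> {for x, continuous g} ->
  {for x, continuous (fun y => row_mx (f y) (g y))}.
Proof.
move=> fc gc A [P PA sPA].
have nf : nbhs (f x) [set u : 'rV[R]_m | forall i j, P i (lshift n j) (u i j)].
  exists (fun i j => P i (lshift n j)) => // i j.
  by rewrite -(row_mxEl (f x) (g x)); exact: PA.
have ng : nbhs (g x) [set u : 'rV[R]_n | forall i j, P i (rshift m j) (u i j)].
  exists (fun i j => P i (rshift m j)) => // i j.
  by rewrite -(row_mxEr (f x) (g x)); exact: PA.
have nfx := fc _ nf; have ngx := gc _ ng.
rewrite /nbhs /= in nfx ngx *.
apply: filterS2 nfx ngx => y /= yf yg; apply: sPA => i j.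
by case: (split_ordP j) => k ->; rewrite /= ?row_mxEl ?row_mxEr.
Qed.

Lemma is_diff_row_mx m n p q (f : 'rV[R]_m -> 'rV[R]_p)
    (g : 'rV[R]_n -> 'rV[R]_q) (v : 'rV[R]_(m + n)) :
  differentiable f (lsubmx v) -> differentiable g (rsubmx v) ->
  is_diff v (fun w => row_mx (f (lsubmx w)) (g (rsubmx w)))
    (fun w => row_mx ('d f (lsubmx v) (lsubmx w)) ('d g (rsubmx v) (rsubmx w))).
Proof.
move=> df dg.
have mulc (a b : nat) (A : 'M[R]_(a, b)) :
    continuous (mulmxr A : 'rV[R]_a -> 'rV[R]_b).
  move=> u B [P PA sPA].
  suff H : forall j, nbhs u [set w : 'rV[R]_a | P ord0 j ((w *m A) ord0 j)].
    have := @filter_forall _ _ _ _ (nbhs_filter u) H.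
    by apply: filterS => w /= Pw; apply: sPA => i j; rewrite ord1; exact: Pw.
  move=> j; have /= := PA ord0 j.
  suff : continuous (fun w : 'rV[R]_a => (w *m A) ord0 j) by move/(_ u); apply.
  have -> : (fun w : 'rV[R]_a => (w *m A) ord0 j) =
            (fun w => \sum_k w ord0 k * A k j) by apply/funext => w; rewrite mxE.
  apply: continuous_big; first exact: add_continuous.
  move=> k _ w; apply: (@cvgMr_tmp _ _ _ _ (fun w : 'rV[R]_a => w ord0 k)).
    exact: (nbhs_filter w).
  exact: (@coord_continuous R 1 a ord0 k w).
have dm (a b : nat) (A : 'M[R]_(a, b)) (u : 'rV[R]_a) :
    is_diff u (mulmxr A : 'rV[R]_a -> 'rV[R]_b) (mulmxr A).
  apply: DiffDef; first by apply: linear_differentiable; exact: mulc.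
  by apply: diff_lin; exact: mulc.
have dl : is_diff v (lsubmx : 'rV[R]_(m + n) -> 'rV[R]_m) lsubmx.
  apply: DiffDef; first exact: differentiable_lsubmx.
  by rewrite diff_lin //; exact: continuous_lsubmx.
have dr : is_diff v (rsubmx : 'rV[R]_(m + n) -> 'rV[R]_n) rsubmx.
  apply: DiffDef; first exact: differentiable_rsubmx.
  by rewrite diff_lin //; exact: continuous_rsubmx.
have rowE (a : 'rV[R]_p) (b : 'rV[R]_q) :
    row_mx a b = a *m row_mx 1%:M 0 + b *m row_mx 0 1%:M.
  by rewrite !mul_mx_row !mulmx1 !mulmx0 add_row_mx addr0 add0r.
under eq_fun do rewrite rowE.
under [X in is_diff _ _ X]eq_fun do rewrite rowE.
apply: (is_diffD (f := mulmxr (row_mx 1%:M 0) \o (f \o lsubmx))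
  (g := mulmxr (row_mx 0 1%:M) \o (g \o rsubmx))
  (df := mulmxr (row_mx 1%:M 0) \o ('d f (lsubmx v) \o lsubmx))
  (dg := mulmxr (row_mx 0 1%:M) \o ('d g (rsubmx v) \o rsubmx))).
- by apply: is_diff_comp; apply: is_diff_comp; exact: differentiableP.
- by apply: is_diff_comp; apply: is_diff_comp; exact: differentiableP.
Qed.

Lemma Ck_row_mx k m n p q (U : set 'rV[R]_m) (V : set 'rV[R]_n)
    (f : 'rV[R]_m -> 'rV[R]_p) (g : 'rV[R]_n -> 'rV[R]_q)
    (h : 'rV[R]_(m + n) -> 'rV[R]_(p + q)) :
  open U -> open V -> Ck k U f -> Ck k V g ->
  (forall v, U (lsubmx v) -> V (rsubmx v) ->
    h v = row_mx (f (lsubmx v)) (g (rsubmx v))) ->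
  Ck k (lsubmx @^-1` U `&` rsubmx @^-1` V) h.
Proof.
move=> Uo Vo; set W := _ `&` _.
have Wo : open W.
  apply: openI; apply: open_comp => // v _.
    exact: continuous_lsubmx.
  exact: continuous_rsubmx.
have nearW h1 (f1 : 'rV[R]_m -> 'rV[R]_p) (g1 : 'rV[R]_n -> 'rV[R]_q) v : W v ->
    (forall v, U (lsubmx v) -> V (rsubmx v) ->
      h1 v = row_mx (f1 (lsubmx v)) (g1 (rsubmx v))) ->
    {near v, (fun w => row_mx (f1 (lsubmx w)) (g1 (rsubmx w))) =1 h1}.
  move=> Wv hE; have := open_nbhs_nbhs (conj Wo Wv).
  by apply: filterS => w [Uw Vw]; rewrite /= hE.
elim: k f g h => [|k IHk] f g h /=.
  move=> fc gc hE v; rewrite inE => -[Uv Vv].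
  apply: near_eq_continuous (nearW _ _ _ _ (conj Uv Vv) hE) _.
  apply: (@row_mx_continuous _ _ _ (f \o lsubmx) (g \o rsubmx)).
  - apply: continuous_comp; first exact: continuous_lsubmx.
    by apply: fc; rewrite inE.
  - apply: continuous_comp; first exact: continuous_rsubmx.
    by apply: gc; rewrite inE.
move=> [df Df] [dg Dg] hE; split=> [v|w].
  rewrite inE => -[Uv Vv].
  apply: near_eq_differentiable (nearW _ _ _ _ (conj Uv Vv) hE) _.
  have df1 := df _ (mem_set Uv); have dg1 := dg _ (mem_set Vv).
  by have := is_diff_row_mx df1 dg1 => ?; exact: ex_diff.
apply: (IHk _ _ _ (Df (lsubmx w)) (Dg (rsubmx w))) => v Uv Vv.
have df1 := df _ (mem_set Uv); have dg1 := dg _ (mem_set Vv).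
rewrite -(near_eq_derive _ (nearW _ _ _ _ (conj Uv Vv) hE)).
have dd := is_diff_row_mx df1 dg1.
by rewrite deriveE ?diff_val ?deriveE //; exact: ex_diff.
Qed.

Section ProductChart.
Variables (S T : topologicalType) (m n : nat).
Variables (c : chart R S m) (d : chart R T n).

Let dom : set (S * T) := cdom c `*` cdom d.
Let fwd (p : S * T) : 'rV[R]_(m + n) := row_mx (cmap c p.1) (cmap d p.2).
Let bwd (v : 'rV[R]_(m + n)) : S * T := (cinv c (lsubmx v), cinv d (rsubmx v)).

Let fwd_img (A : set S) (B : set T) :
  fwd @` (A `*` B) = lsubmx @^-1` (cmap c @` A) `&` rsubmx @^-1` (cmap d @` B).
Proof.
apply/seteqP; split=> [_ [p [Ap Bp] <-]|v [[x Ax xv] [y By yv]]].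
  by rewrite /fwd; split; rewrite /= ?row_mxKl ?row_mxKr; [exists p.1|exists p.2].
by exists (x, y) => //; rewrite /fwd /= xv yv hsubmxK.
Qed.

Fact prod_dom_open : open dom.
Proof.
rewrite openE => -[x y] [/= cx dy]; exists (cdom c, cdom d) => //=.
by split; apply: open_nbhs_nbhs; split=> //; exact: cdom_open.
Qed.

Fact prod_img_open : open (fwd @` dom).
Proof.
rewrite fwd_img; apply: openI; apply: open_comp; try exact: cimg_open.
- by move=> v _; exact: continuous_lsubmx.
- by move=> v _; exact: continuous_rsubmx.
Qed.

Fact prod_fwdK : {in dom, cancel fwd bwd}.
Proof.
move=> [x y]; rewrite inE => -[/= cx dy].
by rewrite /bwd /fwd row_mxKl row_mxKr /= !cmapK ?inE.
Qed.

Fact prod_fwd_continuous : {in dom, continuous fwd}.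
Proof.
move=> [x y]; rewrite inE => -[/= cx dy].
apply: (@row_mx_continuous _ _ _ (cmap c \o fst) (cmap d \o snd)).
  apply: continuous_comp; first exact: cvg_fst.
  by apply: cmap_continuous; rewrite inE.
apply: continuous_comp; first exact: cvg_snd.
by apply: cmap_continuous; rewrite inE.
Qed.

Fact prod_bwd_continuous : {in fwd @` dom, continuous bwd}.
Proof.
move=> v; rewrite fwd_img inE => -[lv rv].
have cc : {for v, continuous (cinv c \o lsubmx)}.
  apply: continuous_comp; first exact: continuous_lsubmx.
  by apply: cinv_continuous; rewrite inE.
have dc : {for v, continuous (cinv d \o rsubmx)}.
  apply: continuous_comp; first exact: continuous_rsubmx.
  by apply: cinv_continuous; rewrite inE.
exact: (cvg_pair cc dc).
Qed.

Definition prod_chart : chart R (S * T)%type (m + n) :=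
  Chart prod_dom_open prod_img_open prod_fwdK prod_fwd_continuous
    prod_bwd_continuous.

Lemma prod_chart_img (A : set S) (B : set T) :
  cmap prod_chart @` (A `*` B) =
  lsubmx @^-1` (cmap c @` A) `&` rsubmx @^-1` (cmap d @` B).
Proof. exact: fwd_img. Qed.

End ProductChart.

Lemma chart_img_open (T : topologicalType) n (c : chart R T n) (A : set T) :
  open A -> open (cmap c @` (cdom c `&` A)).
Proof.
move=> Ao.
have -> : cmap c @` (cdom c `&` A) = cmap c @` cdom c `&` cinv c @^-1` A.
  apply/seteqP; split=> [_ [x [cx Ax] <-]|_ [[x cx <-]]] /=.
    by split; [exists x|rewrite /= cmapK ?inE].
  by rewrite cmapK ?inE // => Ax; exists x.
rewrite openE => v [cv Av].
have nv : nbhs v (cmap c @` cdom c).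
  by apply: open_nbhs_nbhs; split=> //; exact: cimg_open.
have nA : nbhs (cinv c v) A by apply: open_nbhs_nbhs.
exact: filterI nv (cinv_continuous (mem_set cv) nA).
Qed.

Variables M N : manifold R.

Let T := (M * N)%type : topologicalType.

Definition prod_atlas : set (chart R T (mdim M + mdim N)) :=
  [set e | exists c d, [/\ atlas c, atlas d & e = prod_chart c d]].

Fact prod_nonempty : [set: T] !=set0.
Proof.
by have [[x _] [y _]] := (manifold_nonempty M, manifold_nonempty N); exists (x, y).
Qed.

Fact prod_hausdorff : hausdorff_space T.
Proof.
move=> [x y] [x' y'] clu; congr pair.
  apply: (@manifold_hausdorff _ M) => A B Ax Bx'.
  have [| |[u v] [[/= ? _] [/= ? _]]] := clu (A `*` setT) (B `*` setT);
    last by exists u.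
  - by exists (A, setT) => //=; split=> //; exact: filterT.
  - by exists (B, setT) => //=; split=> //; exact: filterT.
apply: (@manifold_hausdorff _ N) => A B Ay By'.
have [| |[u v] [[/= _ ?] [/= _ ?]]] := clu (setT `*` A) (setT `*` B);
  last by exists v.
- by exists (setT, A) => //=; split=> //; exact: filterT.
- by exists (setT, B) => //=; split=> //; exact: filterT.
Qed.

Fact prod_second_countable : @second_countable T.
Proof.
have [B cB [Bo Bb]] := manifold_second_countable M.
have [D cD [Do Db]] := manifold_second_countable N.
exists ((fun UV : set M * set N => UV.1 `*` UV.2) @` (B `*` D)).
  by apply: card_le_trans (card_image_le _ _) _; exact: countableX.
split=> [_ [[U V] [/= BU DV] <-]|[x y] A [[A1 A2] [/= nA1 nA2] sA]].
  rewrite openE => -[x y] [/= Ux Vy]; exists (U, V) => //=.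
  by split; apply: open_nbhs_nbhs; split=> //; [exact: Bo|exact: Do].
have [U [BU Ux] sU] := Bb x _ nA1; have [V [DV Vy] sV] := Db y _ nA2.
exists (U `*` V); first by split=> //; exists (U, V).
by move=> [u v] [/= Uu Vv]; apply: sA; split; [exact: sU|exact: sV].
Qed.

Fact prod_atlas_cover x : exists2 e, prod_atlas e & cdom e x.
Proof.
have [c ac cx] := atlas_cover x.1; have [d ad dx] := atlas_cover x.2.
by exists (prod_chart c d); [exists c, d|split].
Qed.

Fact prod_atlas_compatible e e' :
  prod_atlas e -> prod_atlas e' -> smooth_transition e e'.
Proof.
move=> [c [d [ac ad ->]]] [c' [d' [ac' ad' ->]]] k.
have -> : cdom (prod_chart c d) `&` cdom (prod_chart c' d') =
    (cdom c `&` cdom c') `*` (cdom d `&` cdom d').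
  by apply/seteqP; split=> [x [[? ?] [? ?]]|x [[? ?] [? ?]]].
rewrite prod_chart_img.
apply: Ck_row_mx (atlas_compatible ac ac' k) (atlas_compatible ad ad' k) _.
- exact/chart_img_open/cdom_open.
- exact/chart_img_open/cdom_open.
- by [].
Qed.

Definition prod_manifold : manifold R :=
  Manifold prod_nonempty prod_hausdorff prod_second_countable
    prod_atlas_cover prod_atlas_compatible.

End ProductManifold.

(* The inclusion of R^k into R^n as the first k coordinates, for k <= n. *)
Definition zero_extend {R : realType} {k n : nat} (v : 'rV[R]_k) : 'rV[R]_n :=
  \row_j oapp (v ord0) 0 (insub (val j)).

(* c is a chart of the smooth structure of M (not only of its atlas) in which A
   is the slice where the coordinates of index at least k vanish; the first k
   coordinates then form a chart of the submanifold A. *)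
Definition slice_chart {R : realType} {M : manifold R} (A : set M) (k : nat)
    (c : chart R M (mdim M)) : Prop :=
  [/\ forall d, atlas (m := M) d ->
        smooth_transition c d /\ smooth_transition d c,
      (k <= mdim M)%N &
      forall x, cdom c x ->
        (A x <-> forall j : 'I_(mdim M), (k <= j)%N -> cmap c x ord0 j = 0)].

(* Smoothness of a map defined on an embedded submanifold A of M, expressed in
   the slice charts of A; f is a total function whose values outside A play no
   role.  This is only meant for sets A covered by slice charts. *)
Definition smooth_on_submanifold {R : realType} {M N : manifold R} (A : set M)
    (f : M -> N) : Prop :=
  {within A, continuous f} /\
  forall k c d, slice_chart A k c -> atlas (m := N) d ->
    smooth_on
      [set v : 'rV[R]_k | exists2 x, [/\ cdom c x, A x & cdom d (f x)] &
                                      cmap c x = zero_extend v]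
      (local_rep c d f \o zero_extend).

(* mul g h is the product g h, meaningful only if src g = tgt h. *)
Record groupoid (X G : Type) := Groupoid {
  src : G -> X;
  tgt : G -> X;
  unit_at : X -> G;
  inv : G -> G;
  mul : G -> G -> G;
  src_unit : forall x, src (unit_at x) = x;
  tgt_unit : forall x, tgt (unit_at x) = x;
  src_mul : forall g h, src g = tgt h -> src (mul g h) = src h;
  tgt_mul : forall g h, src g = tgt h -> tgt (mul g h) = tgt g;
  mul_assoc : forall g h l, src g = tgt h -> src h = tgt l ->
    mul g (mul h l) = mul (mul g h) l;
  mul_unit_l : forall g, mul (unit_at (tgt g)) g = g;
  mul_unit_r : forall g, mul g (unit_at (src g)) = g;
  src_inv : forall g, src (inv g) = tgt g;
  tgt_inv : forall g, tgt (inv g) = src g;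
  mul_inv_l : forall g, mul (inv g) g = unit_at (src g);
  mul_inv_r : forall g, mul g (inv g) = unit_at (tgt g)
}.

Definition src_tgt {X G : Type} (H : groupoid X G) (g : G) : X * X :=
  (src H g, tgt H g).

Definition one_orbit {X G : Type} (H : groupoid X G) : Prop :=
  set_surj setT setT (src_tgt H).

Definition composable {X G : Type} (H : groupoid X G) : set (G * G) :=
  [set p | src H p.1 = tgt H p.2].

(* Since src is a submersion, composable is an embedded submanifold of the
   product manifold, so smooth_on_submanifold has its intended meaning. *)
Record lie_groupoid (R : realType) := LieGroupoid {
  objects : manifold R;
  arrows : manifold R;
  lie_groupoidE :> groupoid objects arrows;
  src_submersion : submersion (src lie_groupoidE);
  tgt_submersion : submersion (tgt lie_groupoidE);
  unit_smooth : smooth_map (unit_at lie_groupoidE);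
  inv_smooth : smooth_map (inv lie_groupoidE);
  mul_smooth :
    smooth_on_submanifold (M := prod_manifold arrows arrows) (N := arrows)
      (composable lie_groupoidE)
      (fun p => mul lie_groupoidE p.1 p.2)
}.

Definition transitive_lie_groupoid {R : realType} (L : lie_groupoid R) : Prop :=
  set_surj setT setT (src_tgt L) /\
  submersion (M := arrows L) (N := prod_manifold (objects L) (objects L))
    (src_tgt L).

(* Main.v *)
From HB Require Import structures.
Require Import Defs.
From mathcomp Require Import all_boot all_order all_algebra.
From mathcomp Require Import all_classical all_reals all_analysis.
From mathcomp Require Import perm zify ring lra.

Set Implicit Arguments.
Unset Strict Implicit.
Unset Printing Implicit Defensive.

Import Order.TTheory GRing.Theory Num.Theory numFieldNormedType.Exports.

Local Open Scope classical_set_scope.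
Local Open Scope ring_scope.

(** The rank of the differential of (s,t) is the same at every arrow, and
    Baire's theorem forbids it from being smaller than dim (X x X).

    Constancy of the rank.  Since s is a submersion, the rank of (s,t) at g is
    dim X plus the dimension of the image of ker ds under dt.  Right translation
    by h carries the source fibre of g to that of gh without changing targets,
    so it carries ker ds(g) to ker ds(gh) compatibly with dt; hence the rank at
    g is at most the rank at gh ([arrow_rank_mul]).  Two arrows with the same
    target differ by a right translation, and inversion exchanges sources and
    targets ([arrow_rank_inv]); in a one-orbit groupoid these two moves link any
    arrow to any other ([arrow_rank_le]).  The same inequalities, with h a unit,
    show that the rank does not depend on the charts.

    The product is only known to be smooth in slice charts of the set of
    composable pairs, so such charts have to be built.  The inverse function
    theorem ([inverse_function]) yields, for a map f of rank r at a point,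
    coordinates of its domain whose first r components are linear functions
    of f ([adapted_coordinates]).  For a submersion this straightens its level
    sets ([level_set_parametrization]).

    Maximality of the rank.  If (s,t) had constant rank r < dim (X x X), then in
    adapted coordinates it would locally be a Lipschitz function of r
    coordinates only, and the image of a small neighbourhood of each arrow would
    be nowhere dense, by a count of the cells of a grid ([nowhere_dense_image],
    [constant_rank_nowhere_dense]).  The manifold of arrows being second
    countable, countably many such images cover a chart of X x X, which Baire's
    theorem excludes ([arrow_rank_full]). *)

(** * Calculus of maps of class C^k *)
Section MatrixLinear.
Variable R : realType.

Lemma mx_linear_continuous m n (W : normedModType R)
    (f : {linear 'M[R]_(m, n) -> W}) : continuous f.
Proof.
move=> x.
have -> : (f : _ -> _) = (fun A => \sum_i \sum_j A i j *: f (delta_mx i j)).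
  apply/funext => A; rewrite {1}(matrix_sum_delta A) linear_sum.
  by apply: eq_bigr => i _; rewrite linear_sum; apply: eq_bigr => j _; rewrite linearZ.
apply: continuous_big => // [|i _ {}x]; first exact: add_continuous.
apply: continuous_big => // [|j _ {}x]; first exact: add_continuous.
apply: (@continuous_comp _ _ _ (fun A : 'M[R]_(m, n) => A i j)
  (fun a => a *: f (delta_mx i j))); first exact: coord_continuous.
exact: scalel_continuous.
Qed.

End MatrixLinear.

Section Cr.
Variable R : realType.

(** The same recursion as [Ck], with an arbitrary target, so that it applies to
    scalar functions and to the matrix-valued Jacobian as well. *)
Fixpoint Cr (k : nat) {V W : normedModType R} (U : set V) (f : V -> W) : Prop :=
  match k with
  | 0%N => forall x, U x -> {for x, continuous f}
  | k'.+1 => (forall x, U x -> differentiable f x) /\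
             forall v : V, Cr k' U (fun x => 'D_v f x)
  end.

Definition smooth {V W : normedModType R} (U : set V) (f : V -> W) :=
  forall k, Cr k U f.

Lemma CkE k m n (U : set 'rV[R]_m) (f : 'rV[R]_m -> 'rV[R]_n) :
  Ck k U f <-> Cr k U f.
Proof.
elim: k f => [|k IH] f /=; first by split=> h x; have := h x; rewrite ?inE.
split=> -[df Df]; split=> [x|v].
- by have := df x; rewrite inE.
- exact/IH.
- by rewrite inE; exact: df.
- exact/IH.
Qed.

Lemma smoothE m n (U : set 'rV[R]_m) (f : 'rV[R]_m -> 'rV[R]_n) :
  smooth_on U f <-> smooth U f.
Proof. by split=> h k; apply/CkE. Qed.

Section Basics.
Variables (V W : normedModType R).
Implicit Types (U : set V) (f g : V -> W).

Lemma Cr_ext k U f g : open U -> (forall x, U x -> f x = g x) ->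
  Cr k U f -> Cr k U g.
Proof.
move=> Uo; elim: k f g => [|k IH] f g fg /=.
  move=> fc x Ux; apply: near_eq_continuous (fc x Ux).
  by have := open_nbhs_nbhs (conj Uo Ux); apply: filterS => y; exact: fg.
have nfg x : U x -> {near x, f =1 g}.
  by move=> Ux; have := open_nbhs_nbhs (conj Uo Ux); apply: filterS => y; exact: fg.
move=> [df Df]; split=> [x Ux|v].
  exact: near_eq_differentiable (nfg x Ux) (df x Ux).
by apply: IH (Df v) => x Ux; apply: near_eq_derive; exact: nfg.
Qed.

Lemma CrS k U f : open U -> (forall x, U x -> differentiable f x) ->
  (forall v, exists2 g, Cr k U g & forall x, U x -> 'D_v f x = g x) ->
  Cr k.+1 U f.
Proof.
move=> Uo df Df; split=> // v; have [g gC fg] := Df v.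
by apply: Cr_ext gC => // x Ux; rewrite fg.
Qed.

Lemma CrW k U f : Cr k.+1 U f -> Cr k U f.
Proof.
elim: k f => [|k IH] f [df Df].
  by move=> x Ux; apply: differentiable_continuous; exact: df.
by split=> // v; apply: IH; exact: Df.
Qed.

Lemma Cr_sub k U U' f : U' `<=` U -> Cr k U f -> Cr k U' f.
Proof.
move=> sU; elim: k f => [|k IH] f /=; first by move=> fc x /sU; exact: fc.
by move=> [df Df]; split=> [x /sU|v]; [exact: df|apply: IH].
Qed.

Lemma Cr_cst k U (a : W) : open U -> Cr k U (fun=> a).
Proof.
move=> Uo; elim: k a => [|k IH] a; first by move=> x _; exact: cvg_cst.
apply: CrS => // v; exists (fun=> 0) => // x _; exact: derive_cst.
Qed.

Lemma Cr_add k U f g : open U -> Cr k U f -> Cr k U g ->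
  Cr k U (fun x => f x + g x).
Proof.
move=> Uo; elim: k f g => [|k IH] f g.
  by move=> fc gc x Ux; apply: cvgD; [exact: fc|exact: gc].
move=> [df Df] [dg Dg]; apply: CrS => // [x Ux|v].
  by apply: (differentiableD (df x Ux) (dg x Ux)).
exists (fun x => 'D_v f x + 'D_v g x).
  by apply: IH; [exact: Df|exact: Dg].
by move=> x Ux; apply: deriveD; apply: diff_derivable; [exact: df|exact: dg].
Qed.

Lemma Cr_opp k U f : open U -> Cr k U f -> Cr k U (fun x => - f x).
Proof.
move=> Uo; elim: k f => [|k IH] f.
  by move=> fc x Ux; apply: cvgN; exact: fc.
move=> [df Df]; apply: CrS => // [x Ux|v].
  exact: (differentiableN (df x Ux)).
exists (fun x => - 'D_v f x); first by apply: IH; exact: Df.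
by move=> x Ux; apply: deriveN; apply: diff_derivable; exact: df.
Qed.

Lemma Cr_sum k U I (r : seq I) (P : pred I) (f : I -> V -> W) : open U ->
  (forall i, Cr k U (f i)) -> Cr k U (fun x => \sum_(i <- r | P i) f i x).
Proof.
move=> Uo fC; elim: r => [|i r IH].
  by apply: Cr_ext (Cr_cst k 0 Uo) => // x _; rewrite big_nil.
case Pi: (P i); last by apply: Cr_ext IH => // x _; rewrite big_cons Pi.
by apply: Cr_ext (Cr_add Uo (fC i) IH) => // x _; rewrite big_cons Pi.
Qed.

Lemma Cr_lin k U (f : {linear V -> W}) : open U -> continuous f -> Cr k U f.
Proof.
move=> Uo fc; case: k => [|k]; first by move=> x _; exact: fc.
apply: CrS => // [x _|v]; first exact: linear_differentiable.
exists (fun=> f v); first exact: Cr_cst.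
by move=> x _; rewrite deriveE ?diff_lin //; exact: linear_differentiable.
Qed.

End Basics.

Lemma Cr_lin_comp (V W X : normedModType R) k (U : set V) (f : V -> W)
    (L : {linear W -> X}) : open U ->
  continuous L -> Cr k U f -> Cr k U (L \o f).
Proof.
move=> Uo Lc; elim: k f => [|k IH] f.
  by move=> fc x Ux; apply: continuous_comp; [exact: fc|exact: Lc].
move=> [df Df]; have dL y : differentiable L y by exact: linear_differentiable.
apply: CrS => // [x Ux|v].
  by apply: differentiable_comp => //; exact: df.
exists (L \o (fun x => 'D_v f x)); first by apply: IH; exact: Df.
move=> x Ux; rewrite deriveE; last by apply: differentiable_comp => //; exact: df.
by rewrite diff_comp //= ?diff_lin //; [rewrite deriveE//; exact: df | exact: df].
Qed.

Lemma Cr_mul (V : normedModType R) k (U : set V) (a b : V -> R) : open U ->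
  Cr k U a -> Cr k U b -> Cr k U (fun x => a x * b x).
Proof.
move=> Uo; elim: k a b => [|k IH] a b.
  by move=> ac bc x Ux; apply: cvgM; [exact: ac|exact: bc].
move=> aC bC; have [da Da] := aC; have [db Db] := bC.
apply: CrS => // [x Ux|v].
  by apply: (differentiableM (da x Ux) (db x Ux)).
exists (fun x => a x * 'D_v b x + b x * 'D_v a x).
  by apply: Cr_add => //; apply: IH => //; [exact: CrW|exact: Db|exact: CrW|exact: Da].
by move=> x Ux; apply: deriveM; apply: diff_derivable; [exact: da|exact: db].
Qed.

Lemma Cr_prod (V : normedModType R) k (U : set V) I (r : seq I) (a : I -> V -> R) :
  open U -> (forall i, Cr k U (a i)) -> Cr k U (fun x => \prod_(i <- r) a i x).
Proof.
move=> Uo aC; elim: r => [|i r IH].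
  by apply: Cr_ext (Cr_cst k (1 : R) Uo) => // x _; rewrite big_nil.
by apply: Cr_ext (Cr_mul Uo (aC i) IH) => // x _; rewrite big_cons.
Qed.

Lemma Cr_inv (V : normedModType R) k (U : set V) (a : V -> R) : open U ->
  (forall x, U x -> a x != 0) -> Cr k U a -> Cr k U (fun x => (a x)^-1).
Proof.
move=> Uo an0; elim: k => [|k IH].
  by move=> ac x Ux; apply: cvgV; [exact: an0|exact: ac].
move=> aC; have [da Da] := aC; have iC := IH (CrW aC).
apply: CrS => // [x Ux|v].
  by apply: (differentiableV (da x Ux)); exact: an0.
exists (fun x => (-1) * ((a x)^-1 * (a x)^-1 * 'D_v a x)).
  do !apply: Cr_mul => //; [exact: Cr_cst|exact: Da].
move=> x Ux; have dax := diff_derivable (v := v) (da _ Ux).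
by rewrite (deriveV (an0 _ Ux) dax) mulN1r -expr2 exprVn scaleNr.
Qed.

End Cr.

Section CrMatrix.
Variable R : realType.

Fact entry_linear_subproof m n (i : 'I_m) (j : 'I_n) :
  linear (fun B : 'M[R]_(m, n) => B i j : R).
Proof. by move=> a B C; rewrite !mxE. Qed.

Definition entry_linear m n (i : 'I_m) (j : 'I_n) : {linear 'M[R]_(m, n) -> R} :=
  HB.pack (fun B : 'M[R]_(m, n) => B i j : R)
    (GRing.isLinear.Build _ _ _ _ _ (entry_linear_subproof i j)).

Lemma Cr_entry (V : normedModType R) k (U : set V) m n (A : V -> 'M[R]_(m, n)) i j :
  open U -> Cr k U A -> Cr k U (fun x => A x i j).
Proof.
move=> Uo Ak; apply: (Cr_lin_comp (L := entry_linear i j) Uo _ Ak).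
exact: mx_linear_continuous.
Qed.

(** Finite dimension enters here: products, determinants, inverses and
    composites all reduce to sums and products of scalar functions. *)
Lemma Cr_mx (V : normedModType R) k (U : set V) m n (A : V -> 'M[R]_(m, n)) :
  open U -> (forall i j, Cr k U (fun x => A x i j)) -> Cr k U A.
Proof.
move=> Uo Ak.
have -> : A = (fun x => \sum_i \sum_j A x i j *: delta_mx i j).
  by apply/funext => x; exact: matrix_sum_delta.
apply: Cr_sum => // i; apply: Cr_sum => // j.
have lin : linear (fun a : R => a *: delta_mx i j : 'M[R]_(m, n)).
  by move=> a b c; rewrite scalerDl scalerA.
pose L : {linear R -> 'M[R]_(m, n)} := HB.pack
  (fun a : R => a *: delta_mx i j) (GRing.isLinear.Build _ _ _ _ _ lin).
by apply: (Cr_lin_comp (L := L) Uo _ (Ak i j)); exact: scalel_continuous.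
Qed.

Lemma Cr_mulmx (V : normedModType R) k (U : set V) m n p
    (A : V -> 'M[R]_(m, n)) (B : V -> 'M[R]_(n, p)) :
  open U -> Cr k U A -> Cr k U B -> Cr k U (fun x => A x *m B x).
Proof.
move=> Uo Ak Bk; apply: Cr_mx => // i j.
apply: (@Cr_ext _ _ _ _ _ (fun x => \sum_l A x i l * B x l j)) => //.
  by move=> x _; rewrite mxE.
by apply: Cr_sum => // l; apply: Cr_mul => //; exact: Cr_entry.
Qed.

Lemma Cr_det (V : normedModType R) k (U : set V) n (A : V -> 'M[R]_n) :
  open U -> Cr k U A -> Cr k U (fun x => \det (A x)).
Proof.
move=> Uo Ak; apply: Cr_sum => // s; apply: Cr_mul => //; first exact: Cr_cst.
by apply: Cr_prod => // i; exact: Cr_entry.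
Qed.

(** Cramer's rule expresses the entries of the inverse through determinants. *)
Lemma Cr_invmx (V : normedModType R) k (U : set V) n (A : V -> 'M[R]_n) :
  open U -> (forall x, U x -> A x \in unitmx) -> Cr k U A ->
  Cr k U (fun x => invmx (A x)).
Proof.
move=> Uo Au Ak; apply: Cr_mx => // i j.
apply: (@Cr_ext _ _ _ _ _ (fun x => (\det (A x))^-1 *
    ((-1) ^+ (j + i) * \det (row' j (col' i (A x)))))) => //.
  by move=> x Ux; rewrite /invmx Au // !mxE.
apply: Cr_mul => //.
  apply: Cr_inv => // [x /Au|]; last exact: Cr_det.
  by rewrite unitmxE unitfE.
apply: Cr_mul => //; first exact: Cr_cst.
apply: Cr_det => //; apply: Cr_mx => // a b.
apply: (@Cr_ext _ _ _ _ _ (fun x => A x (lift j a) (lift i b))) => //.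
  by move=> x _; rewrite !mxE.
exact: Cr_entry.
Qed.

Lemma jacobian_spec m n (f : 'rV[R]_m -> 'rV[R]_n) x :
  {A : 'M[R]_(m, n) | forall v, 'd f x v = v *m A}.
Proof. by exists ('J f x) => v; rewrite /jacobian mul_rV_lin1. Qed.

(** The Jacobian matrix, given by its characteristic property only: unlike
    [jacobian] it does not unfold to the choice operator hidden in the
    differential, which conversion would otherwise try to compare. *)
Definition Jac m n (f : 'rV[R]_m -> 'rV[R]_n) x : 'M[R]_(m, n) :=
  sval (jacobian_spec f x).

Lemma diffJ m n (f : 'rV[R]_m -> 'rV[R]_n) x v : 'd f x v = v *m Jac f x.
Proof. exact: (svalP (jacobian_spec f x)). Qed.

Lemma deriveJ m n (f : 'rV[R]_m -> 'rV[R]_n) x v :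
  differentiable f x -> 'D_v f x = v *m Jac f x.
Proof. by move=> df; rewrite (deriveE _ df) diffJ. Qed.

Lemma eq_mulmx_row m n (A B : 'M[R]_(m, n)) :
  (forall v : 'rV[R]_m, v *m A = v *m B) -> A = B.
Proof. by move=> AB; apply/row_matrixP => i; rewrite !rowE. Qed.

(** By the chain rule, a directional derivative of the composite is a
    combination of the partial derivatives of g at f x, with the components of
    the derivative of f as coefficients; the induction applies to each factor. *)
Lemma Cr_comp (V : normedModType R) k (U : set V) n p q
    (U' : set 'rV[R]_n) (f : V -> 'rV[R]_n) (g : 'rV[R]_n -> 'M[R]_(p, q)) :
  open U -> open U' -> (forall x, U x -> U' (f x)) ->
  Cr k U f -> Cr k U' g -> Cr k U (g \o f).
Proof.
move=> Uo U'o fU; elim: k g => [|k IH] g.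
  by move=> fc gc x Ux; apply: continuous_comp; [exact: fc|apply/gc/fU].
move=> fC gC; have [df Df] := fC; have [dg Dg] := gC.
apply: CrS => // [x Ux|v].
  by apply: differentiable_comp; [exact: df|apply/dg/fU].
exists (fun x => \sum_j ('D_v f x) ord0 j *: 'D_(delta_mx ord0 j) g (f x)).
  apply: Cr_sum => // j; apply: Cr_mx => // a b.
  apply: (@Cr_ext _ _ _ _ _ (fun x =>
    ('D_v f x) ord0 j * ('D_(delta_mx ord0 j) g (f x)) a b)) => //.
    by move=> x _; rewrite mxE.
  apply: Cr_mul => //; first by apply: Cr_entry => //; exact: Df.
  apply: Cr_entry => //; apply: (IH (fun y => 'D_(delta_mx ord0 j) g y)).
    exact: CrW.
  exact: Dg.
move=> x Ux; have dfx := df _ Ux; have dgx := dg _ (fU _ Ux).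
rewrite deriveE; last exact: differentiable_comp.
rewrite diff_comp //= -(deriveE v dfx) {1}(row_sum_delta ('D_v f x)) linear_sum.
by apply: eq_bigr => j _; rewrite linearZ (deriveE _ dgx).
Qed.

Lemma smooth_comp (V : normedModType R) (U : set V) n p q
    (U' : set 'rV[R]_n) (f : V -> 'rV[R]_n) (g : 'rV[R]_n -> 'M[R]_(p, q)) :
  open U -> open U' -> (forall x, U x -> U' (f x)) ->
  smooth U f -> smooth U' g -> smooth U (g \o f).
Proof. by move=> Uo U'o fU fC gC k; exact: Cr_comp (fC k) (gC k). Qed.

Lemma smooth_linear m n (W : normedModType R) (U : set 'M[R]_(m, n))
    (f : {linear 'M[R]_(m, n) -> W}) : open U -> smooth U f.
Proof. by move=> Uo k; apply: Cr_lin => //; exact: mx_linear_continuous. Qed.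

Lemma smooth_mulmxr (V : normedModType R) (U : set V) m n p
    (f : V -> 'M[R]_(m, n)) (A : 'M[R]_(n, p)) :
  open U -> smooth U f -> smooth U (fun x => f x *m A).
Proof. by move=> Uo fC k; apply: Cr_mulmx => //; exact: Cr_cst. Qed.

Lemma smooth_differentiable (V W : normedModType R) (U : set V) (f : V -> W) x :
  smooth U f -> U x -> differentiable f x.
Proof. by move=> /(_ 1%N)[df _]; exact: df. Qed.

Lemma smooth_Jac m n (U : set 'rV[R]_m) (f : 'rV[R]_m -> 'rV[R]_n) :
  open U -> smooth U f -> smooth U (fun x => Jac f x).
Proof.
move=> Uo fC k; apply: Cr_mx => // i j.
apply: (@Cr_ext _ _ _ _ _ (fun x => ('D_(delta_mx ord0 i) f x) ord0 j)) => //.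
  move=> x Ux; rewrite deriveJ; last exact: smooth_differentiable Ux.
  by rewrite -rowE mxE.
by apply: Cr_entry => //; have [_] := fC k.+1; exact.
Qed.

Lemma Jac_comp m n p (f : 'rV[R]_m -> 'rV[R]_n) (g : 'rV[R]_n -> 'rV[R]_p) x :
  differentiable f x -> differentiable g (f x) ->
  Jac (g \o f) x = Jac f x *m Jac g (f x).
Proof.
move=> df dg; apply: eq_mulmx_row => v.
by rewrite -(diffJ (g \o f)) diff_comp //= !diffJ mulmxA.
Qed.

Lemma near_eq_Jac m n (f g : 'rV[R]_m -> 'rV[R]_n) x :
  differentiable f x -> {near x, f =1 g} -> Jac f x = Jac g x.
Proof.
move=> df fg; have dg := near_eq_differentiable fg df.
apply: eq_mulmx_row => v; have := near_eq_derive v fg.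
by rewrite (deriveJ _ df) (deriveJ _ dg).
Qed.

Lemma Jac_mulmxr m n (A : 'M[R]_(m, n)) x :
  Jac (mulmxr A : 'rV[R]_m -> 'rV[R]_n) x = A.
Proof.
apply: eq_mulmx_row => v; rewrite -diffJ diff_lin //.
exact: mx_linear_continuous.
Qed.

Lemma differentiable_mulmxr m n (A : 'M[R]_(m, n)) (x : 'rV[R]_m) :
  differentiable (mulmxr A : 'rV[R]_m -> 'rV[R]_n) x.
Proof. by apply: linear_differentiable; exact: mx_linear_continuous. Qed.

Lemma JacD m n (f g : 'rV[R]_m -> 'rV[R]_n) x :
  differentiable f x -> differentiable g x ->
  Jac (fun y => f y + g y) x = Jac f x + Jac g x.
Proof.
move=> df dg; apply: eq_mulmx_row => v; apply/esym/(etrans (mulmxDr _ _ _)).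
apply: etrans (congr2 +%R (esym (diffJ f x v)) (esym (diffJ g x v))) _.
exact: etrans (esym (congr1 (@^~ v) (diffD df dg))) (diffJ (f + g) x v).
Qed.

Lemma JacN m n (f : 'rV[R]_m -> 'rV[R]_n) x :
  differentiable f x -> Jac (fun y => - f y) x = - Jac f x.
Proof.
move=> df; apply: eq_mulmx_row => v; apply/esym/(etrans (mulmxN _ _)).
apply: etrans (congr1 -%R (esym (diffJ f x v))) _.
exact: etrans (esym (congr1 (@^~ v) (diffN df))) (diffJ (- f) x v).
Qed.

Lemma Jac_id m (x : 'rV[R]_m) : Jac id x = 1%:M.
Proof.
apply: eq_mulmx_row => v; rewrite -diffJ mulmx1.
by have ? := @is_diff_id R 'rV[R]_m x; rewrite diff_val.
Qed.

End CrMatrix.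

(** * Mean value inequality and differentiability criteria *)
Section MeanValue.
Variable R : realType.

Lemma mx_norm_le m n (A : 'M[R]_(m, n)) c :
  0 <= c -> (forall i j, `|A i j| <= c) -> `|A| <= c.
Proof.
by move=> c0 Ac; rewrite [leLHS]mx_normrE; apply: bigmax_le => // -[i j] _; exact: Ac.
Qed.

Lemma mx_entry_le m n (A : 'M[R]_(m, n)) i j : `|A i j| <= `|A|.
Proof. by rewrite [leRHS]mx_normrE; apply: (le_bigmax _ _ (i, j)). Qed.

Lemma mulmx_norm m n p (A : 'M[R]_(m, n)) (B : 'M[R]_(n, p)) :
  `|A *m B| <= n%:R * (`|A| * `|B|).
Proof.
apply: mx_norm_le => [|i j]; first by rewrite !mulr_ge0.
rewrite mxE; apply: le_trans (ler_norm_sum _ _ _) _.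
apply: (@le_trans _ _ (\sum_(l < n) `|A| * `|B|)).
  by apply: ler_sum => l _; rewrite normrM ler_pM // mx_entry_le.
by rewrite sumr_const card_ord mulr_natl.
Qed.

(** The norm is the maximum of the components, so the one-variable mean value
    theorem, applied to each component along the segment, suffices.  Only the
    derivative in the direction y - x is bounded: for maps of constant rank this
    direction will be truncated. *)
Lemma mean_value_le m n (f : 'rV[R]_m -> 'rV[R]_n)
    (x y : 'rV[R]_m) (c : R) : 0 <= c ->
  (forall t : R, 0 <= t <= 1 -> differentiable f (x + t *: (y - x)) /\
     `|'d f (x + t *: (y - x)) (y - x)| <= c) ->
  `|f y - f x| <= c.
Proof.
move=> c0 fd; apply: mx_norm_le => // i j; rewrite ord1 {i}.
pose u (t : R) : 'rV[R]_m := x + t *: (y - x).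
have du (t : R) : is_diff t u (fun s => s *: (y - x)).
  apply: (is_diff_eq (is_diffD (is_diff_cst x t) (is_diff_scalel t (y - x)))).
  exact: add0r.
pose L : {linear 'rV[R]_n -> R} := entry_linear R ord0 j.
have Lc : continuous L by exact: mx_linear_continuous.
have dphi (t : R) : 0 <= t <= 1 ->
    is_derive t 1 (L \o f \o u) (L ('d f (u t) (y - x))).
  move=> t01; have [dfu _] := fd t t01.
  have dut : differentiable u t by exact: ex_diff.
  have dL v : differentiable L v by exact: linear_differentiable.
  have dfut : differentiable (L \o f) (u t) by exact: differentiable_comp.
  apply: DeriveDef.
    by apply: diff_derivable; exact: differentiable_comp.
  rewrite deriveE; last exact: differentiable_comp.
  rewrite (diff_comp dut dfut) (diff_comp dfu (dL _)) (diff_lin _ Lc).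
  by rewrite (diff_val (is_diff_def := du t)) /= scale1r.
have dc : {within `[0, 1], continuous (L \o f \o u)}.
  apply: continuous_in_subspaceT => t; rewrite inE /= in_itv /= => t01.
  apply: differentiable_continuous; apply/derivable1_diffP.
  by have [] := dphi t t01.
have [|t t01] := @MVT_segment R (L \o f \o u)
  (fun t => L ('d f (u t) (y - x))) 0 1 ler01 _ dc.
  by move=> t; rewrite in_itv /= => /andP[t0 t1]; apply: dphi; rewrite !ltW.
rewrite in_itv /= in t01.
rewrite subr0 mulr1 /= /u scale1r scale0r addr0 subrKC /L /= => fE.
rewrite !mxE fE; apply: le_trans (mx_entry_le _ _ _) _.
by have [] := fd t t01.
Qed.

Lemma ball_segment (V : normedModType R) (p x y : V) (r t : R) : 0 <= t <= 1 ->
  ball p r x -> ball p r y -> ball p r (x + t *: (y - x)).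
Proof.
move=> /andP[t0 t1]; rewrite -!ball_normE /= => px py.
have -> : p - (x + t *: (y - x)) = (1 - t) *: (p - x) + t *: (p - y).
  have -> : y - x = (p - x) - (p - y) by rewrite opprB [RHS]addrC addrA subrK.
  by rewrite opprD addrA scalerBr opprB scalerBl scale1r addrA addrAC.
apply: le_lt_trans (ler_normD _ _) _.
rewrite !normrZ !ger0_norm ?subr_ge0 //.
have [->|tn0] := eqVneq t 0; first by rewrite subr0 mul1r mul0r addr0.
have -> : r = (1 - t) * r + t * r by rewrite -mulrDl subrK mul1r.
apply: ler_ltD; first by apply: ler_wpM2l; [rewrite subr_ge0|exact: ltW].
by rewrite ltr_pM2l // lt_neqAle eq_sym tn0.
Qed.

Lemma is_diff_eps (V W : normedModType R) (f : V -> W) (L : {linear V -> W}) x :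
  continuous L ->
  (forall e, 0 < e -> \forall y \near x, `|f y - f x - L (y - x)| <= e * `|y - x|) ->
  is_diff x f L.
Proof.
move=> Lc fL.
have fE : f \o shift x = cst (f x) + L +o_ 0 id.
  apply/eqaddoP => e e0.
  have := fL e e0; rewrite (near_shift 0 x) /= => nf.
  apply: filterS nf => y /=; rewrite !fctE /= subr0 addrK.
  by rewrite opprD addrA.
have dE := diff_unique Lc fE.
apply: DiffDef => //; apply/diff_locallyP; rewrite dE; split => //.
Qed.

Lemma diff_eps (V W : normedModType R) (f : V -> W) x (e : R) :
  differentiable f x -> 0 < e ->
  \forall y \near x, `|f y - f x - 'd f x (y - x)| <= e * `|y - x|.
Proof.
move=> /diff_locally /eqaddoP /(_ e) fE /fE fE0.
rewrite (near_shift 0 x) /=; apply: filterS fE0 => y /=.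
by rewrite !fctE /= subr0 addrK opprD addrA.
Qed.

End MeanValue.

(** * The inverse function theorem *)

(** Banach's and Baire's theorems are about complete normed modules; this joins
    the two structures of the space of row vectors. *)
Definition rV_complete (R : realType) n : completeNormedModType R :=
  HB.pack 'rV[R]_n.

Section InverseFunction.
Variable R : realType.

Definition diffeo n (W : set 'rV[R]_n) (f g : 'rV[R]_n -> 'rV[R]_n) :=
  [/\ open W, open (f @` W), smooth W f, smooth (f @` W) g &
      forall x, W x -> g (f x) = x].

Lemma contraction_fixpoint n (h : 'rV[R]_n -> 'rV[R]_n) p w r : 0 < r ->
  (forall x x', `|p - x| <= r -> `|p - x'| <= r ->
     `|h x' - h x| <= 2^-1 * `|x' - x|) ->
  `|p - (h p + w)| <= r / 2 ->
  exists2 x, `|p - x| <= r & x = h x + w.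
Proof.
move=> r0 hL hw; pose T x := h x + w; pose D := closed_ball_ Num.norm p r.
have TD : {homo T : x / D x >-> D x}.
  move=> x; rewrite /D /closed_ball_ /= => px.
  have -> : p - T x = (p - (h p + w)) - (h x - h p).
    rewrite -[RHS]addrA opprB; congr (p + _).
    by rewrite [in RHS]opprD addrACA addNr add0r -opprD addrC.
  apply: le_trans (ler_normB _ _) _; rewrite [r]splitr lerD //.
  rewrite -[r / 2]mulrC; apply: le_trans (hL _ _ _ _) _ => //.
    by rewrite subrr normr0 ltW.
  by rewrite ler_pM2l // distrC.
pose T' : {fun D >-> D} := [fun of mkfun TD].
have ctr : is_contraction T'.
  have q0 : 0 <= (2^-1 : R) by rewrite invr_ge0.
  exists (NngNum q0); split => /=; first by rewrite invf_lt1 // ltr1n.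
  move=> [x x'] /= [Dx Dx'].
  by rewrite /T' /mkfun /= /T opprD addrACA subrr addr0; exact: hL.
have [] := @banach_fixed_point R (rV_complete R n) D T' ctr; first exact: closed_closed_ball_.
- by exists p; rewrite /D /closed_ball_ /= subrr normr0 ltW.
- by move=> x Dx xT; exists x.
Qed.

(** The map x |-> x - f x A^-1, where A is the Jacobian at p, has derivative 0
    at p, so it is a contraction of ratio 1/2 near p. *)
Lemma jacobian_contract n (U : set 'rV[R]_n) f p :
  open U -> U p -> smooth U f -> Jac f p \in unitmx ->
  exists2 e, 0 < e & forall x, ball p e x ->
    [/\ U x, Jac f x \in unitmx & forall x', ball p e x' ->
      let B := invmx (Jac f p) in
      `|(x' - f x' *m B) - (x - f x *m B)| <= 2^-1 * `|x' - x|].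
Proof.
move=> Uo Up fC Ju; set B := invmx (Jac f p).
pose G x := 1%:M + Jac f x *m (- B).
have JC := smooth_Jac Uo fC.
have GC : Cr 0 U G.
  have GC := Cr_mulmx Uo (JC 0%N) (Cr_cst 0 (- B) Uo).
  exact: (Cr_add Uo (Cr_cst 0 (1%:M : 'M[R]_n) Uo) GC).
have Gp : G p = 0 by rewrite /G mulmxN mulmxV // subrr.
pose c : R := (2 * n.+1%:R)^-1.
have c0 : 0 < c by rewrite invr_gt0 mulr_gt0.
have nG : \forall x \near p, `|G x| < c.
  have := GC p Up; rewrite /prop_for /continuous_at Gp => Gc.
  exact: (@cvgr0_norm_lt R 'M[R]_n _ (nbhs p) _ G Gc _ c0).
have nU : \forall x \near p, U x by exact: (open_nbhs_nbhs (conj Uo Up)).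
have nJ : \forall x \near p, \det (Jac f x) != 0.
  have dn0 : \det (Jac f p) != 0 by rewrite -unitfE -unitmxE.
  have dC := Cr_det Uo (JC 0%N); have dc := dC p Up.
  exact: (@cvgr_neq0 R R _ (nbhs p) _ _ _ dc dn0).
have nGUJ : nbhs p [set x | `|G x| < c /\ (U x /\ \det (Jac f x) != 0)].
  exact: filterI nG (filterI nU nJ).
have /nbhs_ballP[e /= e0 be] := nGUJ.
exists e; first exact: e0.
move=> x bx; have [_ [Ux Jx]] := be x bx; split; first exact: Ux.
  by rewrite unitmxE unitfE.
move=> x' bx' /=; pose h y := y + f y *m (- B).
have hE y : y - f y *m B = h y by rewrite /h mulmxN.
rewrite !hE; apply: mean_value_le => [|t t01]; first by rewrite mulr_ge0 ?invr_ge0.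
set z := x + _; have bz : ball p e z by exact: ball_segment.
have [/= Gz [Uz _]] := be z bz.
have dfz := smooth_differentiable fC Uz.
have dg : differentiable (mulmxr (- B) \o f) z.
  by apply: differentiable_comp => //; exact: differentiable_mulmxr.
have did : differentiable (id : 'rV[R]_n -> 'rV[R]_n) z.
  by have ? := @is_diff_id R 'rV[R]_n z; exact: ex_diff.
split; first exact: (differentiableD did dg).
rewrite diffJ; have -> : Jac h z = G z.
  rewrite (JacD did dg) Jac_id (Jac_comp dfz (differentiable_mulmxr _ _)).
  by rewrite Jac_mulmxr.
apply: le_trans (mulmx_norm _ _) _; rewrite mulrCA mulrC.
apply: ler_wpM2r => //.
apply: (@le_trans _ _ (n.+1%:R * c)); first by apply: ler_pM => //; [rewrite ler_nat|exact: ltW].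
by rewrite /c invfM mulrCA mulfV ?mulr1.
Qed.

End InverseFunction.

Section InverseFunctionTheorem.
Variable R : realType.

(** A Lipschitz inverse of a smooth map with invertible Jacobian is smooth: its
    derivative at y is the inverse of the Jacobian at g y, so each further
    degree of differentiability of g follows from the previous one. *)
Section LocalInverse.
Variables (n : nat) (U W : set 'rV[R]_n) (f g : 'rV[R]_n -> 'rV[R]_n) (M : R).
Hypotheses (Uo : open U) (Wo : open W) (Vo : open (f @` W)) (WU : W `<=` U).
Hypotheses (fC : smooth U f) (gK : forall x, W x -> g (f x) = x) (M0 : 0 < M).
Hypothesis Junit : forall x, W x -> Jac f x \in unitmx.
Hypothesis gM : forall x x', W x -> W x' -> `|x' - x| <= M * `|f x' - f x|.

Let V := f @` W.

Let gW y : V y -> W (g y) /\ f (g y) = y.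
Proof. by move=> [x Wx <-]; rewrite gK. Qed.

Let g_lip y y' : V y -> V y' -> `|g y' - g y| <= M * `|y' - y|.
Proof.
move=> /gW[Wg fg] /gW[Wg' fg'].
by have := gM Wg Wg'; rewrite fg fg'.
Qed.

Lemma local_inverse_continuous y : V y -> {for y, continuous g}.
Proof.
move=> Vy; apply/(@cvgrPdist_lt _ _ _ (nbhs y)) => e e0.
have nV : nbhs y V := open_nbhs_nbhs (conj Vo Vy).
have nb : nbhs y (ball y (e / M)) by apply: nbhsx_ballx; rewrite divr_gt0.
apply: filterS2 nV nb => y' Vy'; rewrite -ball_normE /= => yy'.
rewrite distrC; apply: le_lt_trans (g_lip Vy Vy') _.
by rewrite distrC -ltr_pdivlMl // mulrC.
Qed.

Lemma local_inverse_is_diff y : V y ->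
  is_diff y g (mulmxr (invmx (Jac f (g y)))).
Proof.
move=> Vy; have [Wx fx] := gW Vy; set x := g y in Wx fx *.
set C := invmx _.
apply: is_diff_eps => [|e e0]; first exact: mx_linear_continuous.
pose K := n%:R * (M * `|C|) + 1.
have K0 : 0 < K by rewrite ltr_wpDl // !mulr_ge0 // ltW.
have dfx := smooth_differentiable fC (WU Wx).
have nx : nbhs x [set x' | `|f x' - f x - 'd f x (x' - x)| <= e / K * `|x' - x|].
  by apply: (diff_eps dfx); rewrite divr_gt0.
have ng := local_inverse_continuous Vy nx.
have nV : nbhs y V := open_nbhs_nbhs (conj Vo Vy).
apply: filterS2 nV ng => y' Vy' /=; have [Wx' fx'] := gW Vy'.
rewrite -/x; set x' := g y' in Wx' fx' *; rewrite fx fx' diffJ => h.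
have -> : x' - x - (y' - y) *m C = - ((y' - y - (x' - x) *m Jac f x) *m C).
  by rewrite [in RHS]mulmxBl -mulmxA mulmxV ?Junit // mulmx1 opprB.
rewrite normrN; apply: le_trans (mulmx_norm _ _) _.
apply: (@le_trans _ _ (n%:R * (e / K * (M * `|y' - y|) * `|C|))).
  apply: ler_wpM2l => //; apply: ler_wpM2r => //.
  apply: le_trans h _; apply: ler_wpM2l; first by rewrite ltW ?divr_gt0.
  exact: g_lip.
have -> : n%:R * (e / K * (M * `|y' - y|) * `|C|) =
          (n%:R * (M * `|C|) / K) * (e * `|y' - y|).
  by field; rewrite gt_eqF.
apply: ler_piMl; first by rewrite mulr_ge0 // ltW.
by rewrite ler_pdivrMr // mul1r /K lerDl.
Qed.

Lemma local_inverse_smooth : smooth V g.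
Proof.
move=> k; elim: k => [|k IH]; first by move=> y; exact: local_inverse_continuous.
apply: CrS => // [y Vy|v].
  by have := local_inverse_is_diff Vy => ?; exact: ex_diff.
exists ((fun x => v *m invmx (Jac f x)) \o g).
  apply: (Cr_comp (U' := W)) => //.
    by move=> y /gW[].
  apply: Cr_mulmx => //; first exact: Cr_cst.
  apply: Cr_invmx => //; apply: Cr_sub WU _; exact: smooth_Jac.
move=> y Vy; have d := local_inverse_is_diff Vy.
by rewrite deriveE ?diff_val //; exact: ex_diff.
Qed.

End LocalInverse.

(** With h x = x - f x B the contraction of [jacobian_contract], the equation
    f x = y is the fixed point equation x = h x + y B, which Banach's theorem
    solves in a ball; and h being 1/2-Lipschitz, x |-> f x B at most halves
    distances, so that the inverse is Lipschitz. *)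
Theorem inverse_function n (U : set 'rV[R]_n) (f : 'rV[R]_n -> 'rV[R]_n) p :
  open U -> U p -> smooth U f -> Jac f p \in unitmx ->
  exists W g, [/\ diffeo W f g, W p & W `<=` U].
Proof.
move=> Uo Up fC Ju; have [e e0 be] := jacobian_contract Uo Up fC Ju.
set B := invmx (Jac f p) in be.
have Bu : B \in unitmx by rewrite unitmx_inv.
pose h y := y - f y *m B.
have low x x' : ball p e x -> ball p e x' ->
    `|x' - x| <= 2 * `|(f x' - f x) *m B|.
  move=> bx bx'; have [_ _ /(_ x' bx') hL] := be x bx.
  have : `|x' - x| <= 2^-1 * `|x' - x| + `|(f x' - f x) *m B|.
    apply: le_trans (lerD hL (lexx _)); apply: le_trans (ler_normD _ _).
    have -> // : x' - x = (x' - f x' *m B) - (x - f x *m B) + (f x' - f x) *m B.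
    by rewrite mulmxBl opprB -[RHS]addrA [f x *m B - x + _]addrC !subrKA.
  by move: `|x' - x| `|(f x' - f x) *m B| => a b; lra.
pose r := e / 2; have r0 : 0 < r by rewrite divr_gt0.
have re : r < e by rewrite /r ltr_pdivrMr // ltr_pMr // ltr1n.
have sub x : ball p r x -> ball p e x by apply: le_ball; exact: ltW.
pose V := [set y | `|(y - f p) *m B| < r / 2].
pose W := [set x | ball p r x /\ V (f x)].
have Vo : open V.
  have -> : V = (mulmxr B) @^-1` (ball (f p *m B) (r / 2)).
    apply/seteqP; split=> y; rewrite /V /= -ball_normE /= distrC mulmxBl //.
  by apply: open_comp (ball_open _ _) => y _; exact: mx_linear_continuous.
have fc x : ball p e x -> {for x, continuous f}.
  by move=> /be[Ux _ _]; exact: (fC 0%N).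
have Wo : open W.
  rewrite openE => x [bx Vx].
  have nb : nbhs x (ball p r) by apply: open_nbhs_nbhs; split => //; exact: ball_open.
  have nV : nbhs (f x) V by apply: open_nbhs_nbhs.
  exact: filterI nb (fc x (sub _ bx) _ nV).
have Wp : W p.
  split; first exact: ballxx.
  by rewrite /V /= subrr mul0mx normr0 divr_gt0.
have fW : f @` W = V.
  apply/seteqP; split=> [_ [x [_ Vx] <-]//|y Vy].
  have [| |x px xE] := @contraction_fixpoint R n h p (y *m B) r r0.
  - move=> x x' px px'.
    have bx : ball p e x by rewrite -ball_normE /=; exact: le_lt_trans px re.
    have bx' : ball p e x' by rewrite -ball_normE /=; exact: le_lt_trans px' re.
    by have [_ _ /(_ x' bx')] := be x bx.
  - have -> : p - (h p + y *m B) = - ((y - f p) *m B).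
      by rewrite /h mulmxBl opprB !opprD !opprK addrA addrA subrr add0r addrC.
    by rewrite normrN ltW.
  have fx : f x = y.
    have xB : f x *m B = y *m B.
      move: xE; rewrite /h -addrA => /eqP; rewrite -subr_eq0 opprD addrA subrr.
      by rewrite add0r oppr_eq0 addrC subr_eq0 => /eqP.
    by rewrite -[LHS](mulmxK Bu) xB mulmxK.
  exists x => //; split; last by rewrite fx.
  have bx : ball p e x by rewrite -ball_normE /=; exact: le_lt_trans px re.
  rewrite -ball_normE /= distrC.
  apply: le_lt_trans (low p x (ballxx _ e0) bx) _.
  by rewrite fx -ltr_pdivlMl // mulrC.
pose g y := xget p [set x | W x /\ f x = y].
have gK x : W x -> g (f x) = x.
  move=> Wx; have [Wg fg] : W (g (f x)) /\ f (g (f x)) = f x.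
    by apply: (@xgetPex _ p [set z | W z /\ f z = f x]); exists x.
  have := low x (g (f x)) (sub _ Wx.1) (sub _ Wg.1).
  rewrite fg subrr mul0mx normr0 mulr0 normr_le0 subr_eq0 => /eqP //.
have WU : W `<=` U by move=> x [/sub/be[]].
exists W, g; split => //; split => //; first by rewrite fW.
- by move=> k; apply: Cr_sub WU _.
- have Vo' : open (f @` W) by rewrite fW.
  have M0 : 0 < 2 * (n%:R * `|B|) + 1 by rewrite ltr_wpDl // !mulr_ge0.
  have JU x : W x -> Jac f x \in unitmx by move=> [/sub/be[]].
  apply: (local_inverse_smooth Uo Wo Vo' WU fC gK M0 JU).
  move=> x x' [/sub bx _] [/sub bx' _]; apply: le_trans (low _ _ bx bx') _.
  apply: (@le_trans _ _ (2 * (n%:R * `|B|) * `|f x' - f x|)); last first.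
    by rewrite [leRHS]mulrDl mul1r lerDl.
  rewrite -mulrA ler_pM2l //; apply: le_trans (mulmx_norm _ _) _.
  by rewrite -mulrA [`|B| * _]mulrC.
Qed.

End InverseFunctionTheorem.

(** * Maps of constant rank *)
Section AdaptedCoordinates.
Variable R : realType.

(** Writing the Jacobian as C E B with C, B invertible and E the partial identity
    of rank r, the map psi x = x C (1 - E) + f x B^-1 E has Jacobian C at p, so
    that it is a local diffeomorphism, and its first r components are those of
    f x B^-1. *)
Lemma adapted_coordinates m N (U : set 'rV[R]_m) (f : 'rV[R]_m -> 'rV[R]_N) p r :
  open U -> U p -> smooth U f -> \rank (Jac f p) = r ->
  exists W psi phi, exists2 Q : 'M[R]_(N, m), \rank Q = r &
    [/\ diffeo W psi phi, W p, W `<=` U &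
        forall x, psi x *m pid_mx r = f x *m Q].
Proof.
move=> Uo Up fC <- {r}; set J := Jac f p; set r := \rank J.
pose C := col_ebase J; pose B := row_ebase J.
have rm : (r <= m)%N := rank_leq_row J; have rN : (r <= N)%N := rank_leq_col J.
pose Q : 'M[R]_(N, m) := invmx B *m pid_mx r.
pose A : 'M[R]_m := C *m copid_mx r.
pose psi x := mulmxr A x + (mulmxr Q \o f) x.
have psiC : smooth U psi.
  move=> k; apply: (Cr_add Uo); first exact: smooth_linear.
  exact: (smooth_mulmxr Q Uo fC).
have dA : differentiable (mulmxr A : 'rV[R]_m -> 'rV[R]_m) p.
  exact: differentiable_mulmxr.
have df := smooth_differentiable fC Up.
have dQ : differentiable (mulmxr Q : 'rV[R]_N -> 'rV[R]_m) (f p).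
  exact: differentiable_mulmxr.
have Jpsi : Jac psi p = C.
  rewrite (JacD dA (differentiable_comp df dQ)) Jac_mulmxr (Jac_comp df dQ).
  rewrite Jac_mulmxr -/J -{1}[J]mulmx_ebase -/r -/C -/B /Q.
  rewrite mulmxA mulmxK ?row_ebase_unit // -mulmxA mul_pid_mx.
  by rewrite minnn (minn_idPr rN) -mulmxDr subrK mulmx1.
have [|W [phi [dW Wp WU]]] := inverse_function Uo Up psiC.
  by rewrite Jpsi col_ebase_unit.
exists W, psi, phi, Q.
  rewrite /Q (eqmxMfull _ _) ?rank_pid_mx // row_full_unit unitmx_inv.
  exact: row_ebase_unit.
split => // x; rewrite /psi /A /Q /= mulmxDl -!mulmxA.
by rewrite mul_copid_mx_pid // mulmx0 mulmx0 add0r mul_pid_mx minnn (minn_idPr rm).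
Qed.

End AdaptedCoordinates.

Section NowhereDenseImage.
Variable R : realType.

(** F depends only on the first r coordinates, in a Lipschitz way.  If its image
    were dense in a ball of dimension N > r, it would come close to each of the
    M^N points of a grid of step of order 1/M in this ball.  Cutting the cube of
    the first r coordinates into (c M)^r cells, with c fixed and M > c^r, two grid
    points share a cell, and their images are closer than the grid allows. *)
Lemma nowhere_dense_image m N r (F : 'rV[R]_m -> 'rV[R]_N) z0 d L :
  (r < N)%N -> 0 < d -> 0 < L ->
  (forall z z', ball z0 d z -> ball z0 d z' ->
     `|F z' - F z| <= L * `|(z' - z) *m (pid_mx r : 'M[R]_m)|) ->
  (closure (F @` ball z0 d))° = set0.
Proof.
move=> rN d0 L0 FL; apply/seteqP; split=> // y0.
rewrite /interior => /nbhs_ballP[e /= e0 sub].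
(* c is large enough for the images of two points of a common cell to be
   closer than half of the grid step; M > c^r makes the grid points
   outnumber the cells. *)
pose c := (Num.truncn (8 * d * L / e)).+1.
have cP : 8 * d * L / e < c%:R by exact: truncnS_gt.
pose M := (c ^ r).+1; pose K := (c * M).-1.
have KE : K.+1 = (c * M)%N by rewrite prednK.
have M0 : 0 < (M%:R : R) by [].
have c0 : 0 < (c%:R : R) by [].
have K0 : 0 < (K.+1%:R : R) by [].
pose y (k : {ffun 'I_N -> 'I_M}) : 'rV[R]_N :=
  \row_j (y0 ord0 j + e / 2 * (k j)%:R / M%:R).
have hz k : exists z, ball z0 d z /\ `|y k - F z| < e / (8 * M%:R).
  have yb : ball y0 e (y k).
    rewrite -ball_normE /=; apply: (@le_lt_trans _ _ (e / 2)); last first.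
      by rewrite ltr_pdivrMr // ltr_pMr // ltr1n.
    apply: mx_norm_le => [|i j]; first by rewrite divr_ge0 // ltW.
    rewrite ord1 !mxE opprD addrA subrr add0r normrN.
    rewrite ger0_norm; last by rewrite !mulr_ge0 ?invr_ge0 // ltW.
    rewrite ler_pdivrMr // ler_pM2l ?divr_gt0 // ler_nat.
    by rewrite ltnW.
  have [|s [[z bz <-] bs]] := sub _ yb (ball (y k) (e / (8 * M%:R))).
    by apply: nbhsx_ballx; rewrite divr_gt0 // mulr_gt0.
  by exists z; split => //; move: bs; rewrite -ball_normE.
have [z zP] := choice hz.
pose t k (i : 'I_m) := (z k ord0 i - z0 ord0 i + d) * K.+1%:R / (2 * d).
have tP k i : 0 <= t k i < K.+1%:R.
  have [bz _] := zP k.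
  have := mx_entry_le (z0 - z k) ord0 i; rewrite !mxE.
  move: bz; rewrite -ball_normE /= => bz /le_lt_trans/(_ bz).
  rewrite ltr_norml /t => /andP[z1 z2].
  apply/andP; split.
    by apply: divr_ge0; [apply: mulr_ge0; [lra|exact: ltW]|lra].
  by rewrite ltr_pdivrMr; [rewrite mulrC ltr_pM2l //; lra|lra].
pose cell k : {ffun 'I_r -> 'I_K.+1} :=
  [ffun i => inord (if insub (val i) is Some i' then Num.truncn (t k i') else 0%N)].
have [k [k' [kk' ckk']]] : exists k k', k != k' /\ cell k = cell k'.
  apply: contrapT => no.
  have inj : injective cell.
    move=> k k' ck; apply/eqP; apply: contrapT => /negP kk'.
    by apply: no; exists k, k'.
  have := leq_card cell inj; rewrite !card_ffun !card_ord KE leqNgt => /negP; apply.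
  rewrite expnMn; apply: (@leq_trans (M ^ r.+1)); last by rewrite leq_pexp2l.
  by rewrite expnS ltn_pmul2r // expn_gt0.
have [j kj] : exists j, k j != k' j.
  apply: contrapT => no; move/eqP: kk'; apply; apply/ffunP => j.
  by apply/eqP; apply: contrapT => /negP kj; apply: no; exists j.
have [bz yz] := zP k; have [bz' yz'] := zP k'.
have FE : `|F (z k') - F (z k)| <= L * (2 * d / K.+1%:R).
  apply: le_trans (FL _ _ bz bz') _; rewrite ler_pM2l //.
  apply: mx_norm_le => [|i l]; first by rewrite divr_ge0 // mulr_ge0 // ltW.
  rewrite ord1 mxE (bigD1 l) //= big1 ?addr0; last first.
    move=> l' ll'; rewrite [X in _ * X]mxE (_ : (l' == l :> nat) = false) ?mulr0 //.
    exact: negbTE ll'.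
  rewrite !mxE eqxx /=; case: ltnP => lr; last first.
    by rewrite mulr0 normr0 divr_ge0 // mulr_ge0 // ltW.
  rewrite mulr1.
  have := congr1 (fun g : {ffun 'I_r -> 'I_K.+1} => val (g (Ordinal lr))) ckk'.
  have lE : insub (l : nat) = Some l by exact: valK.
  rewrite /cell !ffunE /= lE.
  have /andP[tk0 tk1] := tP k l; have /andP[tk0' tk1'] := tP k' l.
  have tn k0 : 0 <= t k0 l < K.+1%:R -> (Num.truncn (t k0 l) < K.+1)%N.
    move=> /andP[h0 h1]; rewrite -(ltr_nat R); apply: le_lt_trans h1.
    by have /andP[] := truncn_itv h0.
  rewrite !inordK ?tn ?tP // => tt.
  have /andP[a1 a2] := truncn_itv tk0; have /andP[b1 b2] := truncn_itv tk0'.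
  rewrite -tt -natr1 in b1 b2; rewrite -natr1 in a2.
  have dt : `|t k' l - t k l| <= 1 by rewrite ler_norml; apply/andP; split; lra.
  have -> : z k' ord0 l - z k ord0 l = (t k' l - t k l) * (2 * d / K.+1%:R).
    rewrite /t; move: (K.+1%:R : R) K0 => kk kk0.
    by field; rewrite (gt_eqF d0) (gt_eqF kk0).
  rewrite normrM [X in _ * X]ger0_norm; last by rewrite divr_ge0 // mulr_ge0 // ltW.
  by apply: ler_piMl => //; rewrite divr_ge0 // mulr_ge0 // ltW.
have yE : e / (2 * M%:R) <= `|y k - y k'|.
  apply: le_trans (mx_entry_le _ ord0 j); rewrite !mxE.
  have -> : y0 ord0 j + e / 2 * (k j)%:R / M%:R -
      (y0 ord0 j + e / 2 * (k' j)%:R / M%:R) =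
      e / (2 * M%:R) * ((k j)%:R - (k' j)%:R).
    by field; rewrite gt_eqF.
  rewrite normrM ger0_norm; last by rewrite divr_ge0 // ltW.
  apply: ler_peMr; first by rewrite divr_ge0 // ltW.
  move: kj; rewrite neq_ltn => /orP[] lt.
    by rewrite distrC -natrB 1?ltnW // ger0_norm // ler1n subn_gt0.
  by rewrite -natrB 1?ltnW // ger0_norm // ler1n subn_gt0.
have : `|y k - y k'| <= `|y k - F (z k)| + `|F (z k') - F (z k)| + `|y k' - F (z k')|.
  rewrite [`|F _ - _|]distrC [X in _ + _ + X]distrC.
  have -> : y k - y k' = (y k - F (z k)) + (F (z k) - F (z k')) + (F (z k') - y k').
    by rewrite !subrKA.
  by apply: le_trans (ler_normD _ _) _; apply: lerD => //; exact: ler_normD.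
move=> tri.
have : e / (2 * M%:R) < e / (8 * M%:R) + L * (2 * d / K.+1%:R) + e / (8 * M%:R).
  apply: le_lt_trans yE _; apply: le_lt_trans tri _.
  by apply: ltrD => //; apply: ltr_leD.
rewrite KE natrM.
have -> : (e / (2 * M%:R)) = (e / 2) / M%:R by field; rewrite gt_eqF.
have -> : e / (8 * M%:R) + L * (2 * d / (c%:R * M%:R)) + e / (8 * M%:R) =
  (e / 4 + 2 * d * L / c%:R) / M%:R by field; rewrite !gt_eqF.
rewrite ltr_pM2r ?invr_gt0 // => lt.
move: cP; rewrite ltr_pdivrMr // => cP.
have : e / 4 < 2 * d * L / c%:R by lra.
by rewrite ltr_pdivlMr // => lt2; lra.
Qed.

End NowhereDenseImage.

Section ConstantRank.
Variable R : realType.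

(** When B does not lower the rank of A, its kernel meets the image of A
    trivially. *)
Lemma mulmx_ker_rank m n p (w : 'rV[R]_m) (A : 'M[R]_(m, n)) (B : 'M[R]_(n, p)) :
  (\rank A <= \rank (A *m B))%N -> w *m (A *m B) = 0 -> w *m A = 0.
Proof.
move=> rAB wAB; have := mxrank_mul_ker A B => rE.
have : (\rank (A :&: kermx B) <= 0)%N.
  by rewrite -(leq_add2l (\rank (A *m B))) rE addn0.
rewrite leqn0 mxrank_eq0 => /eqP cap0; apply/eqP; rewrite -submx0 -cap0.
by rewrite sub_capmx submxMl; apply/sub_kermxP; rewrite -mulmxA.
Qed.

(** In adapted coordinates, the first r coordinates are recovered linearly from
    the value of the map, so the differential of the map has rank at least r, and
    as its rank is r it vanishes on the vectors whose first r coordinates vanish.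
    By the mean value inequality the map is then a Lipschitz function of the
    first r coordinates. *)
Lemma constant_rank_nowhere_dense m N (r : nat) (U : set 'rV[R]_m) (f : 'rV[R]_m -> 'rV[R]_N) p :
  open U -> U p -> smooth U f -> (forall x, U x -> \rank (Jac f x) = r) ->
  (r < N)%N ->
  exists O, [/\ open O, O p, O `<=` U & (closure (f @` O))° = set0].
Proof.
move=> Uo Up fC fr rN.
have [W [psi [phi [Q _ [[Wo Vo psiC phiC psiK] Wp WU psiQ]]]]] :=
  adapted_coordinates Uo Up fC (fr p Up).
set V := psi @` W in Vo phiC.
have rm : (r <= m)%N by rewrite -(fr p Up) rank_leq_row.
have phiV z : V z -> W (phi z) /\ psi (phi z) = z.
  by move=> [x Wx <-]; rewrite psiK.
pose F := f \o phi.
have FC : smooth V F.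
  by apply: (smooth_comp Vo Uo _ phiC fC) => z /phiV[/WU].
have FQ z : V z -> F z *m Q = z *m pid_mx r.
  by move=> /phiV[Wz zE]; rewrite /F /= -psiQ zE.
have JQ z : V z -> Jac F z *m Q = pid_mx r.
  move=> Vz; have dF := smooth_differentiable FC Vz.
  have dQ := differentiable_mulmxr Q (F z).
  rewrite -[LHS](_ : Jac (mulmxr Q \o F) z = _); last first.
    by rewrite (Jac_comp dF dQ) Jac_mulmxr.
  rewrite -[RHS](Jac_mulmxr (pid_mx r : 'M[R]_m) z); apply: near_eq_Jac.
    exact: differentiable_comp dF dQ.
  by apply: filterS (open_nbhs_nbhs (conj Vo Vz)) => y /FQ.
have JF0 z (w : 'rV[R]_m) : V z -> w *m (pid_mx r : 'M[R]_m) = 0 -> w *m Jac F z = 0.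
  move=> Vz; rewrite -(JQ z Vz); apply: mulmx_ker_rank.
  rewrite JQ // rank_pid_mx //; have [Wz _] := phiV z Vz.
  have dphi := smooth_differentiable phiC Vz.
  have df := smooth_differentiable fC (WU _ Wz).
  by rewrite (Jac_comp dphi df) -(fr _ (WU _ Wz)) mxrankM_maxr.
set z0 := psi p; have Vz0 : V z0 by exists p.
pose c := `|Jac F z0| + 1; have c0 : 0 < c by rewrite ltr_wpDl.
have nJ : nbhs z0 [set z | `|Jac F z| <= c].
  have JC := smooth_Jac Vo FC 0%N z0 Vz0.
  have nn : nbhs z0 [set z | `|Jac F z0 - Jac F z| < 1].
    exact: (@cvgr_dist_lt _ _ _ (nbhs z0) _ _ _ JC 1 ltr01).
  apply: filterS nn => z /= /ltW h; rewrite /c -lerBlDl; apply: le_trans h.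
  by rewrite distrC; exact: (lerB_dist (Jac F z) (Jac F z0)).
have nV : nbhs z0 V := open_nbhs_nbhs (conj Vo Vz0).
have nJV : nbhs z0 [set z | `|Jac F z| <= c /\ V z] :=
  @filterI _ _ (nbhs_filter z0) _ _ nJ nV.
have /nbhs_ballP[d /= d0 bd] := nJV.
exists (W `&` psi @^-1` ball z0 d); split.
- rewrite openE => x [Wx bx].
  have nW : nbhs x W := open_nbhs_nbhs (conj Wo Wx).
  have nb : nbhs (psi x) (ball z0 d).
    by apply: open_nbhs_nbhs; split => //; exact: ball_open.
  exact: filterI nW (psiC 0%N x Wx _ nb).
- by split => //; exact: ballxx.
- by move=> x [/WU].
apply/seteqP; split=> // y; have := @nowhere_dense_image R m N r F z0 d (m%:R * c + 1) rN d0.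
have L0 : 0 < m%:R * c + 1 by rewrite ltr_wpDl // mulr_ge0 // ltW.
move=> /(_ L0) thin; rewrite -thin; last first.
  move=> z z' bz bz'; apply: mean_value_le => [|t t01].
    by rewrite mulr_ge0 // ltW.
  set u := z + _; have bu : ball z0 d u by exact: ball_segment.
  have [Ju Vu] := bd u bu; split; first exact: smooth_differentiable FC Vu.
  rewrite diffJ.
  have -> : (z' - z) *m Jac F u = (z' - z) *m (pid_mx r : 'M[R]_m) *m Jac F u.
    apply/eqP; rewrite -subr_eq0 -mulmxBl; apply/eqP; apply: JF0 => //.
    by rewrite mulmxBl -mulmxA mul_pid_mx !minnn (minn_idPr rm) subrr.
  apply: le_trans (mulmx_norm _ _) _.
  rewrite mulrCA mulrC; apply: ler_wpM2r => //.
  by apply: ler_wpDr => //; rewrite ler_wpM2l.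
by apply/interiorS/closureS => _ [x [Wx bx] <-]; exists (psi x); rewrite // /F /= psiK.
Qed.

Lemma no_countable_nowhere_dense_cover N (S : nat -> set 'rV[R]_N) (O : set 'rV[R]_N) :
  open O -> O !=set0 -> (forall i, (closure (S i))° = set0) ->
  ~ O `<=` \bigcup_i S i.
Proof.
move=> Oo O0 S0 sub.
have [i|y [Oy]] := @Baire R (rV_complete R N) (fun i => ~` closure (S i)) _ O O0 Oo.
  split; first exact/closed_openC/closed_closure.
  move=> D [y Dy] Do; apply: contrapT => no.
  have DS : D `<=` closure (S i).
    by move=> x Dx; apply: contrapT => nx; apply: no; exists x.
  have : (closure (S i))° y by apply: (interiorS DS); rewrite ((interior_id D).1 Do).
  by rewrite S0.
move=> notS; have [i _ Siy] := sub y Oy.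
by apply: (notS i I); exact: subset_closure.
Qed.

End ConstantRank.

(** * Straightening level sets; slice charts *)
Section Straighten.
Variable R : realType.

Lemma diffeo_linear n (W : set 'rV[R]_n) f g (A : 'M[R]_n) : A \in unitmx ->
  diffeo W f g -> diffeo W (fun x => f x *m A) (fun y => g (y *m invmx A)).
Proof.
move=> Au [Wo Vo fC gC gK].
have VE : (fun x => f x *m A) @` W = mulmxr (invmx A) @^-1` (f @` W).
  apply/seteqP; split=> [_ [x Wx <-]|y [x Wx fx]] /=.
    by exists x => //; rewrite mulmxK.
  by exists x => //; rewrite fx /= mulmxKV.
have V'o : open ((fun x => f x *m A) @` W).
  by rewrite VE; apply: open_comp Vo => y _; exact: mx_linear_continuous.
split => //; first exact: smooth_mulmxr.
  apply: (smooth_comp V'o Vo _ _ gC (f := mulmxr (invmx A))).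
    by move=> y; rewrite VE.
  exact: smooth_linear.
by move=> x Wx; rewrite mulmxK // gK.
Qed.

Lemma mul_pid_mx_entry n r (v : 'rV[R]_n) (j : 'I_n) :
  (v *m (pid_mx r : 'M[R]_n)) ord0 j = if (j < r)%N then v ord0 j else 0.
Proof.
rewrite mxE (bigD1 j) //= big1 ?addr0 => [|l lj].
  by rewrite mxE eqxx /=; case: ifP => _; rewrite ?mulr1 ?mulr0.
by rewrite mxE (_ : (l == j :> nat) = false) ?mulr0 //; exact: negbTE lj.
Qed.

(** Adapted coordinates of F, in reverse order: the slices of [slice_chart] are
    where the last coordinates vanish, whereas adapted coordinates put the
    components of F first. *)
Lemma straighten_level_set n d (U : set 'rV[R]_n) (F : 'rV[R]_n -> 'rV[R]_d) p :
  open U -> U p -> smooth U F -> \rank (Jac F p) = d ->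
  exists W (psi phi : 'rV[R]_n -> 'rV[R]_n), [/\ diffeo W psi phi, W p, W `<=` U,
    (forall x, W x ->
      (F x = 0 <-> forall j : 'I_n, (n - d <= j)%N -> psi x ord0 j = 0)) &
    (forall v : 'rV[R]_n, v *m Jac F p = 0 ->
      forall j : 'I_n, (n - d <= j)%N -> (v *m Jac psi p) ord0 j = 0)].
Proof.
move=> Uo Up FC rF.
have [W [psi [phi [Q rQ [dW Wp WU psiQ]]]]] := adapted_coordinates Uo Up FC rF.
have dn : (d <= n)%N by rewrite -rF rank_leq_row.
(* P reverses the order of the coordinates. *)
pose P : 'M[R]_n := perm_mx (perm rev_ord_inj).
have PE (v : 'rV[R]_n) j : (v *m P) ord0 j = v ord0 (rev_ord j).
  rewrite mxE (bigD1 (rev_ord j)) //= big1 ?addr0 => [|l lj].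
    by rewrite !mxE permE rev_ordK eqxx mulr1.
  rewrite !mxE permE; case: eqVneq => [E|_]; last by rewrite mulr0.
  by rewrite -E rev_ordK eqxx in lj.
have Pu : P \in unitmx by exact: unitmx_perm.
have pidP (v : 'rV[R]_n) : v *m (pid_mx d : 'M[R]_n) = 0 <->
    forall j : 'I_n, (n - d <= j)%N -> (v *m P) ord0 j = 0.
  split=> [v0 j jd|v0].
    rewrite PE; have := congr1 (fun w : 'rV[R]_n => w ord0 (rev_ord j)) v0.
    by rewrite mul_pid_mx_entry mxE; case: ltnP => // jd'; exfalso; move: jd' (ltn_ord j) => /=; lia.
  apply/rowP => j; rewrite mul_pid_mx_entry mxE; case: ltnP => // jd.
  have := v0 (rev_ord j); rewrite PE rev_ordK; apply => /=.
  by have := ltn_ord j; lia.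
exists W, (fun x => psi x *m P), (fun y => phi (y *m invmx P)); split => //.
- exact: diffeo_linear.
- move=> x Wx; split=> [Fx|/pidP].
    by apply/pidP; rewrite psiQ Fx mul0mx.
  rewrite psiQ => FQ; apply: (row_free_inj (A := Q)); last by rewrite FQ mul0mx.
  by rewrite /row_free rQ.
move=> v vF; have [_ _ psiC _ _] := dW.
have dpsi := smooth_differentiable psiC Wp.
have dF := smooth_differentiable FC Up.
have -> : v *m Jac (fun x => psi x *m P) p = v *m Jac psi p *m P.
  by rewrite -mulmxA -[P in RHS](Jac_mulmxr P (psi p)) 
    -(Jac_comp dpsi (differentiable_mulmxr P _)).
apply/pidP.
have E : mulmxr (pid_mx d) \o psi = mulmxr Q \o F by apply/funext => x; exact: psiQ.
have := congr1 (fun f => Jac f p) E.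
rewrite (Jac_comp dpsi (differentiable_mulmxr _ _)).
rewrite (Jac_comp dF (differentiable_mulmxr _ _)) !Jac_mulmxr => JE.
by rewrite -mulmxA JE mulmxA vF mul0mx.
Qed.

End Straighten.

(** Composing a chart with a diffeomorphism gives a chart of the same smooth
    structure, although not one of the atlas. *)
Section RefineChart.
Variables (R : realType) (T : topologicalType) (n : nat) (c : chart R T n).
Variables (W : set 'rV[R]_n) (psi phi : 'rV[R]_n -> 'rV[R]_n).
Hypotheses (dW : diffeo W psi phi) (Wc : W `<=` cmap c @` cdom c).

Let dom := cdom c `&` cmap c @^-1` W.

Let img : (psi \o cmap c) @` dom = psi @` W.
Proof.
apply/seteqP; split=> [_ [x [_ Wx] <-]|_ [_ /[dup] /Wc[x cx <-] Wx <-]].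
  by exists (cmap c x).
by exists x.
Qed.

Fact refine_dom_open : open dom.
Proof.
rewrite openE => x [cx Wx].
have nd : nbhs x (cdom c) by apply: open_nbhs_nbhs; split => //; exact: cdom_open.
have [Wo _ _ _ _] := dW.
have nW : nbhs (cmap c x) W := open_nbhs_nbhs (conj Wo Wx).
exact: filterI nd (cmap_continuous (mem_set cx) nW).
Qed.

Fact refine_img_open : open ((psi \o cmap c) @` dom).
Proof. by rewrite img; have [] := dW. Qed.

Fact refineK : {in dom, cancel (psi \o cmap c) (cinv c \o phi)}.
Proof.
move=> x; rewrite inE => -[cx Wx] /=.
by have [_ _ _ _ ->//] := dW; rewrite cmapK ?inE.
Qed.

Fact refine_continuous : {in dom, continuous (psi \o cmap c)}.
Proof.
move=> x; rewrite inE => -[cx Wx]; apply: continuous_comp.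
  by apply: cmap_continuous; rewrite inE.
by have [_ _ psiC _ _] := dW; exact: (psiC 0%N).
Qed.

Fact refine_inv_continuous :
  {in (psi \o cmap c) @` dom, continuous (cinv c \o phi)}.
Proof.
have [_ _ _ phiC phiK] := dW.
move=> y; rewrite img inE => Vy; apply: continuous_comp; first exact: (phiC 0%N).
by apply: cinv_continuous; rewrite inE; case: Vy => x Wx <-; rewrite phiK //; exact: Wc.
Qed.

Definition refine_chart : chart R T n :=
  Chart refine_dom_open refine_img_open refineK refine_continuous
    refine_inv_continuous.

Lemma refine_transition_l (d : chart R T n) :
  smooth_transition c d -> smooth_transition refine_chart d.
Proof.
have [_ Vo _ phiC phiK] := dW.
move=> /smoothE cd; apply/smoothE.
have Do : open (cmap refine_chart @` (cdom refine_chart `&` cdom d)).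
  exact/chart_img_open/cdom_open.
apply: (smooth_comp Do _ _ _ cd (f := phi)).
- exact/chart_img_open/cdom_open.
- move=> _ [x [[cx Wx] dx] <-] /=; rewrite phiK //; by exists x.
- move=> k; apply: Cr_sub (phiC k).
  by move=> _ [x [[cx Wx] dx] <-] /=; exists (cmap c x).
Qed.

Lemma refine_transition_r (d : chart R T n) :
  smooth_transition d c -> smooth_transition d refine_chart.
Proof.
have [Wo _ psiC _ _] := dW.
move=> /smoothE cd; apply/smoothE.
have Do : open (cmap d @` (cdom d `&` cdom refine_chart)).
  exact/chart_img_open/cdom_open.
apply: (smooth_comp Do Wo _ _ psiC (f := cmap c \o cinv d)).
- by move=> _ [x [dx [cx Wx]] <-] /=; rewrite cmapK ?inE.
- move=> k; apply: Cr_sub (cd k).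
  by move=> _ [x [dx [cx Wx]] <-] /=; exists x.
Qed.

End RefineChart.

(** * Local representatives and their Jacobians *)
Section LocalRep.
Variable R : realType.

Definition rep_dom (M N : topologicalType) m n (c : chart R M m) (d : chart R N n)
  (f : M -> N) : set 'rV[R]_m := cmap c @` (cdom c `&` f @^-1` cdom d).

Lemma open_rep_dom (M N : topologicalType) m n (c : chart R M m) (d : chart R N n)
  (f : M -> N) : continuous f -> open (rep_dom c d f).
Proof.
by move=> fc; apply: chart_img_open; apply: open_comp (cdom_open d) => x _; exact: fc.
Qed.

Lemma smooth_rep (M N : manifold R) (c : chart R M (mdim M))
    (d : chart R N (mdim N)) (f : M -> N) :
  smooth_map f -> atlas c -> atlas d -> smooth (rep_dom c d f) (local_rep c d f).
Proof. by move=> [_ fC] ac ad; apply/smoothE; exact: fC. Qed.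

Lemma differentiable_rep (M N : manifold R) (c : chart R M (mdim M))
    (d : chart R N (mdim N)) (f : M -> N) x :
  smooth_map f -> atlas c -> atlas d -> cdom c x -> cdom d (f x) ->
  differentiable (local_rep c d f) (cmap c x).
Proof.
move=> fC ac ad cx dfx; apply: smooth_differentiable (smooth_rep fC ac ad) _.
by exists x.
Qed.

Lemma submersion_rank (M N : manifold R) (c : chart R M (mdim M))
    (d : chart R N (mdim N)) (f : M -> N) x :
  submersion f -> atlas c -> atlas d -> cdom c x -> cdom d (f x) ->
  \rank (Jac (local_rep c d f) (cmap c x)) = mdim N.
Proof.
move=> [_ fS] ac ad cx dfx; apply/eqP; change (row_full (Jac (local_rep c d f) (cmap c x))).
apply/row_fullP.
have ex i : exists v : 'rV[R]_(mdim M),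
    v *m Jac (local_rep c d f) (cmap c x) = delta_mx ord0 i.
  have [v _ vE] := fS c d ac ad x cx dfx (delta_mx ord0 i) I.
  by exists v; rewrite -diffJ.
have [v vE] := choice ex.
exists (\matrix_(i, j) v i ord0 j); apply/row_matrixP => i; rewrite row_mul.
have -> : row i (\matrix_(i, j) v i ord0 j) = v i.
  by apply/rowP => j; rewrite !mxE.
by rewrite vE rowE mulmx1.
Qed.

Lemma near_cinv (M : topologicalType) m (c : chart R M m) x (A : set M) :
  cdom c x -> nbhs x A ->
  \forall u \near cmap c x,
    [/\ A (cinv c u), cdom c (cinv c u) & cmap c (cinv c u) = u].
Proof.
move=> cx nA.
have ic : (cmap c @` cdom c) (cmap c x) by exists x.
have nA' : nbhs (cinv c (cmap c x)) A by rewrite cmapK ?inE.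
have n1 : nbhs (cmap c x) (cinv c @^-1` A) := cinv_continuous (mem_set ic) nA'.
have n2 := open_nbhs_nbhs (conj (@cimg_open _ _ _ c) ic).
by apply: filterS2 n1 n2 => u Au [y cy yu]; split => //;
  rewrite -yu cmapK ?inE.
Qed.

Lemma near_rep_comp (M N P : topologicalType) m n p (c : chart R M m)
    (d : chart R N n) (e : chart R P p) (f : M -> N) (h : N -> P) x :
  continuous f -> cdom c x -> cdom d (f x) ->
  \forall u \near cmap c x,
    (local_rep d e h \o local_rep c d f) u = local_rep c e (h \o f) u.
Proof.
move=> fc cx dfx.
have nd : nbhs x (f @^-1` cdom d).
  by apply: fc; apply: open_nbhs_nbhs; split => //; exact: cdom_open.
apply: filterS (near_cinv cx nd) => u [du cu _].
by rewrite /local_rep /= cmapK ?inE.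
Qed.

Lemma Jac_rep_comp (M N P : manifold R) (c : chart R M (mdim M))
    (d : chart R N (mdim N)) (e : chart R P (mdim P)) (f : M -> N) (h : N -> P) x :
  smooth_map f -> smooth_map h -> atlas c -> atlas d -> atlas e ->
  cdom c x -> cdom d (f x) -> cdom e (h (f x)) ->
  Jac (local_rep c e (h \o f)) (cmap c x) =
  Jac (local_rep c d f) (cmap c x) *m Jac (local_rep d e h) (cmap d (f x)).
Proof.
move=> fC hC ac ad ae cx dfx ehx.
have df := differentiable_rep fC ac ad cx dfx.
have dh := differentiable_rep hC ad ae dfx ehx.
have fE : local_rep c d f (cmap c x) = cmap d (f x).
  by rewrite /local_rep /= cmapK ?inE.
rewrite -fE in dh *; rewrite -(Jac_comp df dh); apply/esym.
apply: near_eq_Jac; first exact: differentiable_comp df dh.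
by apply: near_rep_comp => //; have [] := fC.
Qed.

End LocalRep.

Section RankComparison.
Variable F : fieldType.

(** The rank of (S,T) is the rank of S plus that of T restricted to ker S. *)
Lemma rank_row_mx m n p (S : 'M[F]_(m, n)) (T : 'M[F]_(m, p)) :
  \rank (row_mx S T) = (\rank S + \rank (kermx S *m T))%N.
Proof.
have E : (kermx (row_mx S T) :=: kermx S :&: kermx T)%MS.
  apply/eqmxP/andP; split.
    rewrite sub_capmx; apply/andP; split; apply/sub_kermxP.
      have /(congr1 lsubmx) := mulmx_ker (row_mx S T).
      by rewrite mul_mx_row row_mxKl linear0.
    have /(congr1 rsubmx) := mulmx_ker (row_mx S T).
    by rewrite mul_mx_row row_mxKr linear0.
  apply/sub_kermxP; rewrite mul_mx_row.
  have /sub_kermxP -> : ((kermx S :&: kermx T)%MS <= kermx S)%MS by exact: capmxSl.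
  have /sub_kermxP -> : ((kermx S :&: kermx T)%MS <= kermx T)%MS by exact: capmxSr.
  by rewrite row_mx0.
have k1 := mxrank_ker (row_mx S T); have k2 := mxrank_ker S.
have k3 := mxrank_mul_ker (kermx S) T.
have r1 := rank_leq_row S; have r2 := rank_leq_row (row_mx S T).
rewrite E in k1; lia.
Qed.

(** The hypothesis says that T' (ker S') contains T (ker S). *)
Lemma rank_row_mx_le m m' n p (S : 'M[F]_(m, n)) (T : 'M[F]_(m, p))
    (S' : 'M[F]_(m', n)) (T' : 'M[F]_(m', p)) :
  \rank S = \rank S' ->
  (forall u : 'rV_m, u *m S = 0 -> exists2 q : 'rV_m', q *m S' = 0 & q *m T' = u *m T) ->
  (\rank (row_mx S T) <= \rank (row_mx S' T'))%N.
Proof.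
move=> rS H; rewrite !rank_row_mx rS leq_add2l; apply: mxrankS.
apply/row_subP => i; rewrite row_mul.
have [|q qS <-] := H (row i (kermx S)).
  by rewrite -row_mul mulmx_ker row0.
by apply: submxMr; exact/sub_kermxP.
Qed.

End RankComparison.

(** * Smooth maps on level sets *)
Section LevelSet.
Variable R : realType.

Lemma zero_extendE k n (v : 'rV[R]_k) : zero_extend v = v *m pid_mx k :> 'rV[R]_n.
Proof.
apply/rowP => j; rewrite !mxE; case: insubP => [i _ ij|]/=.
  rewrite (bigD1 i) //= big1 ?addr0 => [|l li].
    by rewrite mxE ij eqxx -ij ltn_ord mulr1.
  rewrite mxE -ij (_ : (l == i :> nat) = false) ?mulr0 //; exact: negbTE li.
rewrite -leqNgt => kj; rewrite big1 // => l _; rewrite mxE.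
rewrite (_ : (l == j :> nat) = false) ?mulr0 //; apply/eqP => lj.
by have := ltn_ord l; rewrite lj ltnNge kj.
Qed.

Lemma zero_extend_pid k n (w : 'rV[R]_n) : (k <= n)%N ->
  (forall j : 'I_n, (k <= j)%N -> w ord0 j = 0) ->
  w *m pid_mx k *m (pid_mx k : 'M[R]_(k, n)) = w.
Proof.
move=> kn w0; rewrite -mulmxA pid_mx_id //.
apply/rowP => j; rewrite mul_pid_mx_entry; case: ltnP => // jk.
by rewrite w0.
Qed.

(** The inverse of a slice chart parametrises the level set A of the submersion F
    near x; its tangent space there is the kernel of the differential of F, and f
    is differentiable in this parametrisation. *)
Lemma level_set_parametrization (M N : manifold R) (A : set M) (f : M -> N)
    (c : chart R M (mdim M)) (x : M) d (U : set 'rV[R]_(mdim M))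
    (F : 'rV[R]_(mdim M) -> 'rV[R]_d) :
  smooth_on_submanifold A f -> atlas c -> cdom c x -> A x ->
  open U -> U `<=` cmap c @` cdom c -> U (cmap c x) ->
  smooth U F -> \rank (Jac F (cmap c x)) = d ->
  (forall y, cdom c y -> U (cmap c y) -> (A y <-> F (cmap c y) = 0)) ->
  exists k (zeta : 'rV[R]_k -> 'rV[R]_(mdim M)) v0,
    [/\ differentiable zeta v0, zeta v0 = cmap c x,
        forall w : 'rV[R]_(mdim M), w *m Jac F (cmap c x) = 0 ->
          exists y : 'rV[R]_k, y *m Jac zeta v0 = w,
        forall e, atlas e -> cdom e (f x) ->
          differentiable (cmap e \o f \o cinv c \o zeta) v0 &
        forall O, nbhs (f x) O -> \forall v \near v0,
          A (cinv c (zeta v)) /\ O (f (cinv c (zeta v)))].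
Proof.
move=> [fA fC] ac cx Ax Uo Uc Ux FC rF AF.
set n := mdim M in U F Uo Uc Ux FC rF AF *.
have [W [psi [phi [dW Wx WU psiF psiJ]]]] := straighten_level_set Uo Ux FC rF.
have Wc : W `<=` cmap c @` cdom c by move=> u /WU/Uc.
pose c' := refine_chart dW Wc; pose k := (n - d)%N.
have kn : (k <= n)%N by exact: leq_subr.
have [Wo Vo psiC phiC psiK] := dW.
have sl : slice_chart A k c'.
  split => [e ae| //|y [cy Wy]].
    split; first by apply: refine_transition_l; exact: atlas_compatible.
    by apply: refine_transition_r; exact: atlas_compatible.
  by apply: iff_trans (AF y cy (WU _ Wy)) _; exact: psiF.
have c'x : cdom c' x by split.
pose v0 : 'rV[R]_k := psi (cmap c x) *m pid_mx k.
have psi0 : psi (cmap c x) = v0 *m pid_mx k.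
  by rewrite zero_extend_pid // => j; have [_ _ /(_ x c'x)[+ _]] := sl; apply.
pose E : 'M[R]_(k, n) := pid_mx k.
pose zeta : 'rV[R]_k -> 'rV[R]_n := phi \o mulmxr E.
have VE : (psi @` W) (v0 *m E) by rewrite -psi0; exists (cmap c x).
have dE : differentiable (mulmxr E : 'rV[R]_k -> 'rV[R]_n) v0.
  exact: differentiable_mulmxr.
have dphi : differentiable phi (mulmxr E v0) by exact: smooth_differentiable phiC VE.
have z0 : zeta v0 = cmap c x by rewrite /zeta /= -psi0 psiK.
have zA v : (psi @` W) (v *m E) -> A (cinv c (zeta v)).
  move=> VvE; have [y Wy yE] := VvE; have [x' cx' x'y] := Wc _ Wy.
  have zy : zeta v = y by rewrite /zeta /= -yE psiK.
  rewrite zy -x'y cmapK ?inE //.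
  have c'x' : cdom c' x' by split => //=; rewrite x'y.
  have [_ _ /(_ x' c'x')[_ H]] := sl; apply: H => j kj.
  rewrite /= x'y yE -zero_extendE /zero_extend mxE insubN //=.
  by rewrite -leqNgt.
have nV : nbhs v0 [set v | (psi @` W) (v *m E)].
  have cE : continuous (mulmxr E : 'rV[R]_k -> 'rV[R]_n) by exact: mx_linear_continuous.
  exact: cE (open_nbhs_nbhs (conj Vo VE)).
have zc : {for v0, continuous (cinv c \o zeta)}.
  apply: continuous_comp.
    apply: differentiable_continuous; exact: differentiable_comp.
  by rewrite z0; apply: cinv_continuous; rewrite inE; exists x.
exists k, zeta, v0; split => //.
- exact: differentiable_comp.
- move=> w wF; have w0 := psiJ w wF.
  exists (w *m Jac psi (cmap c x) *m pid_mx k).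
  rewrite (Jac_comp dE dphi) Jac_mulmxr mulmxA zero_extend_pid //=.
  have dpsi := smooth_differentiable psiC Wx.
  have dphi' : differentiable phi (psi (cmap c x)) by rewrite psi0.
  have dc := differentiable_comp dpsi dphi'.
  have nid : {near cmap c x, phi \o psi =1 id}.
    by apply: filterS (open_nbhs_nbhs (conj Wo Wx)) => u /psiK.
  have J1 := near_eq_Jac dc nid.
  rewrite (Jac_comp dpsi dphi') Jac_id in J1.
  by rewrite -psi0 -mulmxA J1 mulmx1.
- move=> e ae efx; have /smoothE fCe := fC k c' e sl ae.
  have := smooth_differentiable fCe (x := v0).
  have -> : local_rep c' e f \o zero_extend = cmap e \o f \o cinv c \o zeta.
    by apply/funext => v; rewrite /= zero_extendE.
  by apply; exists x => //; rewrite /= psi0 zero_extendE.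
move=> O nO; have nA : within A (nbhs x) (f @^-1` O).
  by rewrite (nbhs_subspace_in Ax); exact: fA x _ nO.
have nzO : nbhs v0 ((cinv c \o zeta) @^-1` [set y | A y -> O (f y)]).
  by apply: zc; rewrite /= z0 cmapK ?inE.
by apply: filterS2 nV nzO => v Vv Ov; split; [exact: zA|apply/Ov/zA].
Qed.

End LevelSet.

(** * The rank of the source-target map is constant *)
Lemma rank_row_mxC (F : fieldType) m n p (A : 'M[F]_(m, n)) (B : 'M[F]_(m, p)) :
  \rank (row_mx A B) = \rank (row_mx B A).
Proof.
by rewrite -mxrank_tr -[RHS]mxrank_tr !tr_row_mx -!addsmxE addsmxC.
Qed.

Lemma mul_row_diff (F : fieldType) q m n (u w : 'M[F]_(q, m)) (S T : 'M[F]_(m, n)) :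
  row_mx u w *m (col_mx 1%:M 0 *m S - col_mx 0 1%:M *m T) = u *m S - w *m T.
Proof.
by rewrite mulmxBr !mulmxA !mul_row_col !mulmx1 !mulmx0 addr0 add0r.
Qed.

Section ArrowRank.
Variables (R : realType) (L : lie_groupoid R).
Local Notation X := (objects L).
Local Notation G := (arrows L).
Local Notation d := (mdim X).
Local Notation m := (mdim G).
Implicit Types (c : chart R G m) (e : chart R X d).

(** The rank at g of the differential of (s,t), in the given charts. *)
Definition arrow_rank c e e' (g : G) : nat :=
  \rank (row_mx (Jac (local_rep c e (src L)) (cmap c g))
                (Jac (local_rep c e' (tgt L)) (cmap c g))).

Definition charts_at c e e' (g : G) :=
  [/\ atlas c, atlas e & atlas e'] /\
  [/\ cdom c g, cdom e (src L g) & cdom e' (tgt L g)].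

Let sC : smooth_map (src L). Proof. exact: (src_submersion L).1. Qed.
Let tC : smooth_map (tgt L). Proof. exact: (tgt_submersion L).1. Qed.

(** Inversion exchanges source and target. *)
Lemma arrow_rank_inv c c' e e' g : charts_at c e e' g -> charts_at c' e' e (Defs.inv L g) ->
  (arrow_rank c e e' g <= arrow_rank c' e' e (Defs.inv L g))%N.
Proof.
move=> [[ac ae ae'] [cg eg e'g]] [[ac' _ _] [c'g e'g' eg']].
have iC := inv_smooth L.
have sE : src L = tgt L \o Defs.inv L by apply/funext => x; rewrite /= tgt_inv.
have tE : tgt L = src L \o Defs.inv L by apply/funext => x; rewrite /= src_inv.
have S := Jac_rep_comp iC tC ac ac' ae cg c'g eg'.
have T := Jac_rep_comp iC sC ac ac' ae' cg c'g e'g'.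
rewrite -sE in S; rewrite -tE in T.
rewrite /arrow_rank S T -mul_mx_row.
apply: leq_trans (mxrankM_maxr _ _) _.
by apply: eq_leq; exact: rank_row_mxC.
Qed.

(** Near (g, h), the composable pairs are the zeros of the difference F of the
    source of the first arrow and the target of the second, read in a chart e of
    the objects; F is a submersion because s is. *)
Section Composable.
Variables (g h : G) (c1 c2 : chart R G m) (e : chart R X d).
Hypothesis gh : src L g = tgt L h.
Hypotheses (a1 : atlas c1) (a2 : atlas c2) (ae : atlas e).
Hypotheses (c1g : cdom c1 g) (c2h : cdom c2 h) (eg : cdom e (src L g)).

Let eh : cdom e (tgt L h). Proof. by rewrite -gh. Qed.
Let pl : 'M[R]_(m + m, m) := col_mx 1%:M 0.
Let pr : 'M[R]_(m + m, m) := col_mx 0 1%:M.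
Let plE (u : 'rV[R]_(m + m)) : u *m pl = lsubmx u.
Proof. by rewrite -[u in LHS]hsubmxK mul_row_col mulmx1 mulmx0 addr0. Qed.
Let prE (u : 'rV[R]_(m + m)) : u *m pr = rsubmx u.
Proof. by rewrite -[u in LHS]hsubmxK mul_row_col mulmx1 mulmx0 add0r. Qed.

Let f1 := local_rep c1 e (src L).
Let f2 := local_rep c2 e (tgt L).
Let U : set 'rV[R]_(m + m) :=
  mulmxr pl @^-1` rep_dom c1 e (src L) `&` mulmxr pr @^-1` rep_dom c2 e (tgt L).
Let F (u : 'rV[R]_(m + m)) : 'rV[R]_d := (f1 \o mulmxr pl) u + - (f2 \o mulmxr pr) u.
Let p : 'rV[R]_(m + m) := row_mx (cmap c1 g) (cmap c2 h).

Let Uo : open U.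
Proof.
apply: openI; apply: open_comp; try (by move=> u _; exact: mx_linear_continuous).
  by apply: open_rep_dom; exact: sC.1.
by apply: open_rep_dom; exact: tC.1.
Qed.

Let Up : U p.
Proof.
split; rewrite /= ?plE ?prE /p ?row_mxKl ?row_mxKr.
  by exists g.
by exists h.
Qed.

Let FC : smooth U F.
Proof.
have s1 : smooth U (f1 \o mulmxr pl).
  apply: (smooth_comp Uo (open_rep_dom sC.1) _ _ (smooth_rep sC a1 ae) (f := mulmxr pl)).
    by move=> u [].
  exact: smooth_linear.
have s2 : smooth U (f2 \o mulmxr pr).
  apply: (smooth_comp Uo (open_rep_dom tC.1) _ _ (smooth_rep tC a2 ae) (f := mulmxr pr)).
    by move=> u [].
  exact: smooth_linear.
by move=> k; apply: (Cr_add Uo (s1 k)); exact: Cr_opp.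
Qed.

Let S1 := Jac f1 (cmap c1 g).
Let T2 := Jac f2 (cmap c2 h).

Let JF : Jac F p = pl *m S1 - pr *m T2.
Proof.
have lp : mulmxr pl p = cmap c1 g by rewrite /= plE row_mxKl.
have rp : mulmxr pr p = cmap c2 h by rewrite /= prE row_mxKr.
have d1 : differentiable f1 (mulmxr pl p).
  by rewrite lp; exact: differentiable_rep.
have d2 : differentiable f2 (mulmxr pr p).
  by rewrite rp; exact: differentiable_rep.
have dl := differentiable_mulmxr pl p; have dr := differentiable_mulmxr pr p.
have dl1 := differentiable_comp dl d1; have dr2 := differentiable_comp dr d2.
have := JacD dl1 (differentiableN dr2).
rewrite (JacN dr2) (Jac_comp dl d1) (Jac_comp dr d2) !Jac_mulmxr lp rp.
exact.
Qed.

Let rF : \rank (Jac F p) = d.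
Proof.
have rS : \rank S1 = d by apply: submersion_rank => //; exact: src_submersion.
apply/eqP; rewrite eqn_leq rank_leq_col /=.
have S1E : row_mx 1%:M 0 *m Jac F p = S1.
  apply: etrans (congr1 (mulmx _) JF) _; apply: etrans (mul_row_diff _ _ _ _) _.
  by move: S1 T2 => S T; rewrite mul1mx mul0mx subr0.
by apply: leq_trans (eq_leq (esym rS)) _; rewrite -S1E; exact: mxrankM_maxr.
Qed.

(** A parametrisation (a, b) of the composable pairs in which the product mu is
    differentiable.  If u is tangent to the source fibre at g, then (u, 0) is
    tangent to the composable pairs: this is the infinitesimal right translation
    by h. *)
Lemma composable_parametrization (c3 : chart R G m) :
  atlas c3 -> cdom c3 (Defs.mul L g h) ->
  exists k (a b mu : 'rV[R]_k -> 'rV[R]_m) v0,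
  [/\ [/\ differentiable a v0, differentiable b v0 & differentiable mu v0],
      [/\ a v0 = cmap c1 g, b v0 = cmap c2 h & mu v0 = cmap c3 (Defs.mul L g h)],
      (forall u : 'rV[R]_m, u *m S1 = 0 -> exists y : 'rV[R]_k,
        y *m Jac a v0 = u /\ y *m Jac b v0 = 0) &
      \forall v \near v0, [/\ src L (cinv c1 (a v)) = tgt L (cinv c2 (b v)),
        cdom c3 (Defs.mul L (cinv c1 (a v)) (cinv c2 (b v))) &
        mu v = cmap c3 (Defs.mul L (cinv c1 (a v)) (cinv c2 (b v)))]].
Proof.
move=> a3 c3k.
pose GG := prod_manifold G G; pose pc : chart R GG (mdim GG) := prod_chart c1 c2.
have apc : atlas (m := GG) pc by exists c1, c2.
have pcx : cdom pc (g, h) by [].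
have Upc : U `<=` cmap pc @` cdom pc.
  move=> u [/= [x [cx _] xu] [y [cy _] yu]]; exists (x, y) => //.
  by rewrite /= xu yu plE prE hsubmxK.
have AF (y : GG) : cdom pc y -> U (cmap pc y) ->
    (composable L y <-> F (cmap pc y) = 0).
  case: y => [y1 y2] [/= cy1 cy2] [/=]; rewrite plE prE row_mxKl row_mxKr.
  move=> [x1 [cx1 ex1] /(congr1 (cinv c1))]; rewrite !cmapK ?inE // => xy1.
  move=> [x2 [cx2 ex2] /(congr1 (cinv c2))]; rewrite !cmapK ?inE // => xy2.
  rewrite /= {}xy1 in ex1; rewrite /= {}xy2 in ex2.
  rewrite /composable /F /= plE prE row_mxKl row_mxKr /f1 /f2 /local_rep /=.
  rewrite !cmapK ?inE //; split=> [->|/eqP]; first by rewrite subrr.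
  rewrite subr_eq0 => /eqP/(congr1 (cinv e)).
  by rewrite !cmapK ?inE.
have [k [zeta [v0 [dz z0 zk zmul znear]]]] :=
  level_set_parametrization (mul_smooth L) apc pcx gh Uo Upc Up FC rF AF.
have dl := differentiable_mulmxr pl (zeta v0).
have dr := differentiable_mulmxr pr (zeta v0).
exists k, (mulmxr pl \o zeta), (mulmxr pr \o zeta).
exists (cmap c3 \o (fun q => Defs.mul L q.1 q.2) \o cinv pc \o zeta), v0; split.
- by split; [exact: differentiable_comp dz dl|exact: differentiable_comp dz dr|exact: zmul].
- rewrite /= z0 /= plE prE row_mxKl row_mxKr !cmapK ?inE //.
- move=> u uS.
  have [|y yz] := zk (row_mx u 0).
    have -> : cmap pc (g, h) = p by [].
    apply: etrans (congr1 (mulmx _) JF) _; apply: etrans (mul_row_diff _ _ _ _) _.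
    by rewrite uS mul0mx subr0.
  exists y; rewrite (Jac_comp dz dl) (Jac_comp dz dr) !Jac_mulmxr !mulmxA yz.
  by rewrite plE prE row_mxKl row_mxKr.
have nO : nbhs (Defs.mul L g h) (cdom c3).
  by apply: open_nbhs_nbhs; split => //; exact: cdom_open.
apply: filterS (znear _ nO) => v [/= comp c3v].
by rewrite !plE !prE; split.
Qed.

End Composable.

(** Let y be a vector of parameters mapped to (u, 0), with u in ker ds(g).  Its
    image under the differential of the product lies in ker ds(gh), as the source
    of the product is that of the second factor, and it has the same image as u
    under dt, as the target of the product is that of the first factor. *)
Lemma arrow_rank_mul c c' e e1 e2 (g h : G) : src L g = tgt L h ->
  charts_at c e e2 g -> charts_at c' e1 e2 (Defs.mul L g h) ->
  (arrow_rank c e e2 g <= arrow_rank c' e1 e2 (Defs.mul L g h))%N.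
Proof.
move=> gh [[ac ae ae2] [cg eg e2g]] [[ac' ae1 _] [c'k e1k e2k]].
have [ch ach chh] := atlas_cover h.
have e1h : cdom e1 (src L h) by rewrite -(src_mul gh).
have [k [a [b [mu [v0 [[da db dmu] [a0 b0 mu0] ker near]]]]]] :=
  composable_parametrization gh ac ach ae cg chh eg ac' c'k.
set S1 := Jac _ (cmap c g) in ker.
have rS : \rank S1 = d by apply: submersion_rank => //; exact: src_submersion.
have dS' := differentiable_rep sC ac' ae1 c'k e1k.
have dT' := differentiable_rep tC ac' ae2 c'k e2k.
have dT := differentiable_rep tC ac ae2 cg e2g.
have dSh := differentiable_rep sC ach ae1 chh e1h.
rewrite -mu0 in dS' dT'; rewrite -a0 in dT; rewrite -b0 in dSh.
have ET : Jac mu v0 *m Jac (local_rep c' e2 (tgt L)) (mu v0) =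
          Jac a v0 *m Jac (local_rep c e2 (tgt L)) (a v0).
  apply: etrans (esym (Jac_comp dmu dT')) (etrans _ (Jac_comp da dT)).
  apply: near_eq_Jac; first exact: differentiable_comp dmu dT'.
  apply: filterS near => v [comp c'v muv].
  rewrite /local_rep /= muv cmapK; last by rewrite inE.
  by rewrite (tgt_mul comp).
have ES : Jac mu v0 *m Jac (local_rep c' e1 (src L)) (mu v0) =
          Jac b v0 *m Jac (local_rep ch e1 (src L)) (b v0).
  apply: etrans (esym (Jac_comp dmu dS')) (etrans _ (Jac_comp db dSh)).
  apply: near_eq_Jac; first exact: differentiable_comp dmu dS'.
  apply: filterS near => v [comp c'v muv].
  rewrite /local_rep /= muv cmapK; last by rewrite inE.
  by rewrite (src_mul comp).
have rS' := submersion_rank (src_submersion L) ac' ae1 c'k e1k.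
apply: rank_row_mx_le (etrans rS (esym rS')) _.
move=> u uS; have [y [ya yb]] := ker u uS.
rewrite mu0 in ES ET; rewrite a0 in ET.
exists (y *m Jac mu v0); apply: etrans (esym (mulmxA y _ _)) _.
  apply: etrans (congr1 (mulmx y) ES) _; apply: etrans (mulmxA _ _ _) _.
  exact: etrans (congr1 (fun z => z *m _) yb) (mul0mx _ _).
apply: etrans (congr1 (mulmx y) ET) _; apply: etrans (mulmxA _ _ _) _.
exact: (congr1 (fun z => z *m _) ya).
Qed.

(** The arrow g' is the product of g and of g^-1 g'. *)
Lemma arrow_rank_tgt c c' e e1 e2 (g g' : G) : tgt L g = tgt L g' ->
  charts_at c e e2 g -> charts_at c' e1 e2 g' ->
  (arrow_rank c e e2 g <= arrow_rank c' e1 e2 g')%N.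
Proof.
move=> gg' cg cg'; pose h := Defs.mul L (Defs.inv L g) g'.
have ig : src L (Defs.inv L g) = tgt L g' by rewrite src_inv.
have gh : src L g = tgt L h by rewrite tgt_mul // tgt_inv.
have kE : Defs.mul L g h = g'.
  by rewrite mul_assoc ?tgt_inv // mul_inv_r gg' mul_unit_l.
by rewrite -kE; apply: arrow_rank_mul gh cg _; rewrite kE.
Qed.

(** Choose k from the source of g' to the target of g: it has the target of g,
    and its inverse has the target of g'^-1. *)
Lemma arrow_rank_le c c' e1 e2 e1' e2' (g g' : G) : one_orbit L ->
  charts_at c e1 e2 g -> charts_at c' e1' e2' g' ->
  (arrow_rank c e1 e2 g <= arrow_rank c' e1' e2' g')%N.
Proof.
move=> orb cg cg'.
have [k _ [ks kt]] := orb (src L g', tgt L g) I.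
have [ck ack ckk] := atlas_cover k.
have [ci aci cik] := atlas_cover (Defs.inv L k).
have [ci' aci' cig'] := atlas_cover (Defs.inv L g').
have [[_ ae1 ae2] [_ _ e2g]] := cg; have [[_ ae1' ae2'] [_ e1g' e2g']] := cg'.
have ck_at : charts_at ck e1' e2 k by split; split; rewrite ?ks ?kt.
have ci_at : charts_at ci e2 e1' (Defs.inv L k).
  by split; split; rewrite ?src_inv ?tgt_inv ?ks ?kt.
have ci'_at : charts_at ci' e2' e1' (Defs.inv L g').
  by split; split; rewrite ?src_inv ?tgt_inv.
apply: leq_trans (arrow_rank_tgt _ cg ck_at) _; first by rewrite kt.
apply: leq_trans (arrow_rank_inv ck_at ci_at) _.
apply: leq_trans (arrow_rank_tgt _ ci_at ci'_at) _; first by rewrite !tgt_inv ks.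
have gE : Defs.inv L (Defs.inv L g') = g'.
  have ii : src L (Defs.inv L (Defs.inv L g')) = tgt L (Defs.inv L g') by rewrite src_inv.
  rewrite -[LHS](mul_unit_r L) src_inv tgt_inv -(mul_inv_l L g') mul_assoc ?src_inv //.
  by rewrite mul_inv_l src_inv mul_unit_l.
have ci'' : charts_at c' e1' e2' (Defs.inv L (Defs.inv L g')) by rewrite gE.
apply: leq_trans (arrow_rank_inv ci'_at ci'') _.
exact: eq_leq (congr1 (arrow_rank c' e1' e2') gE).
Qed.

End ArrowRank.

(** * The source-target map is a submersion *)
Section RowMx.
Variable R : realType.

Lemma row_mx_mulmxE m n (a : 'rV[R]_m) (b : 'rV[R]_n) :
  row_mx a b = a *m row_mx 1%:M 0 + b *m row_mx 0 1%:M.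
Proof. by rewrite !mul_mx_row !mulmx1 !mulmx0 add_row_mx addr0 add0r. Qed.

Variables (m p q : nat) (f : 'rV[R]_m -> 'rV[R]_p) (g : 'rV[R]_m -> 'rV[R]_q).

Let E : (fun u => row_mx (f u) (g u)) =
  (fun u => (mulmxr (row_mx 1%:M 0) \o f) u + (mulmxr (row_mx 0 1%:M) \o g) u).
Proof. by apply/funext => u; exact: row_mx_mulmxE. Qed.

Lemma smooth_row_mx (U : set 'rV[R]_m) : open U -> smooth U f -> smooth U g ->
  smooth U (fun u => row_mx (f u) (g u)).
Proof.
move=> Uo fC gC k; rewrite E.
exact: (Cr_add Uo (smooth_mulmxr (row_mx 1%:M 0) Uo fC k)
                  (smooth_mulmxr (row_mx 0 1%:M) Uo gC k)).
Qed.

Lemma Jac_row_mx x : differentiable f x -> differentiable g x ->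
  Jac (fun u => row_mx (f u) (g u)) x = row_mx (Jac f x) (Jac g x).
Proof.
move=> df dg.
pose A : 'M[R]_(p, p + q) := row_mx 1%:M 0.
pose B : 'M[R]_(q, p + q) := row_mx 0 1%:M.
have dA : differentiable (mulmxr A : 'rV[R]_p -> 'rV[R]_(p + q)) (f x).
  exact: differentiable_mulmxr.
have dB : differentiable (mulmxr B : 'rV[R]_q -> 'rV[R]_(p + q)) (g x).
  exact: differentiable_mulmxr.
apply: etrans (congr1 (fun h => Jac h x) E) _.
apply: etrans (JacD (differentiable_comp df dA) (differentiable_comp dg dB)) _.
rewrite (Jac_comp df dA) (Jac_comp dg dB) !Jac_mulmxr /A /B.
by rewrite !mul_mx_row !mulmx1 !mulmx0 add_row_mx addr0 add0r.
Qed.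

End RowMx.

Section SourceTarget.
Variables (R : realType) (L : lie_groupoid R).
Local Notation X := (objects L).
Local Notation G := (arrows L).
Local Notation d := (mdim X).
Local Notation m := (mdim G).
Local Notation XX := (prod_manifold X X).

Let st : G -> XX := src_tgt L.
Let sC : smooth_map (src L). Proof. exact: (src_submersion L).1. Qed.
Let tC : smooth_map (tgt L). Proof. exact: (tgt_submersion L).1. Qed.

Lemma src_tgt_continuous : continuous st.
Proof. by move=> x; apply: cvg_pair; [exact: sC.1|exact: tC.1]. Qed.

Lemma smooth_src_tgt (c : chart R G m) (e e' : chart R X d) :
  atlas c -> atlas e -> atlas e' ->
  smooth (rep_dom c (prod_chart e e') st) (local_rep c (prod_chart e e') st).
Proof.
move=> ac ae ae'.
have Do : open (rep_dom c (prod_chart e e') st).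
  exact: (open_rep_dom (d := prod_chart e e') src_tgt_continuous).
apply: (@smooth_row_mx R m d d (local_rep c e (src L)) (local_rep c e' (tgt L))
  _ Do) => k.
  by apply: Cr_sub (smooth_rep sC ac ae k) => _ [x [cx [ex _]] <-]; exists x.
by apply: Cr_sub (smooth_rep tC ac ae' k) => _ [x [cx [_ ex]] <-]; exists x.
Qed.

Lemma src_tgt_smooth_map : smooth_map (N := XX) st.
Proof.
split; first exact: src_tgt_continuous.
by move=> c _ ac [e [e' [ae ae' ->]]]; apply/smoothE; exact: smooth_src_tgt.
Qed.

Lemma rank_src_tgt (c : chart R G m) (e e' : chart R X d) g : charts_at c e e' g ->
  \rank (Jac (local_rep c (prod_chart e e') st) (cmap c g)) = arrow_rank c e e' g.
Proof.
move=> [[ac ae ae'] [cg eg e'g]].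
have dS := differentiable_rep sC ac ae cg eg.
have dT := differentiable_rep tC ac ae' cg e'g.
exact: (congr1 (fun A => \rank A) (Jac_row_mx dS dT)).
Qed.

Lemma enum_countable (T : Type) (B : set (set T)) : countable B ->
  exists u : nat -> set T, forall b, B b -> exists i, u i = b.
Proof.
move=> /countable_injP[f finj].
exists (fun i => xget set0 [set b | B b /\ f b = i]) => b Bb.
exists (f b); have [Bb' fb'] := @xgetPex _ set0
  [set b' | B b' /\ f b' = f b] (ex_intro _ b (conj Bb erefl)).
by apply: finj; rewrite ?inE.
Qed.

(** Otherwise each arrow has a neighbourhood whose image in a chart of X x X is
    nowhere dense; a countable base of the arrows then gives a countable
    covering of this chart by nowhere dense sets. *)
Lemma arrow_rank_full (c : chart R G m) (e e' : chart R X d) (g : G) :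
  one_orbit L -> charts_at c e e' g ->
  arrow_rank c e e' g = (d + d)%N.
Proof.
move=> orb cg; set r := arrow_rank c e e' g.
have rle : (r <= d + d)%N by exact: rank_leq_col.
apply/eqP; rewrite eqn_leq rle leqNgt; apply/negP => rlt.
have rE (c' : chart R G m) (e1 e1' : chart R X d) (g' : G) :
    charts_at c' e1 e1' g' -> arrow_rank c' e1 e1' g' = r.
  move=> cg'; apply/eqP; rewrite eqn_leq; apply/andP; split.
    exact: arrow_rank_le orb cg' cg.
  exact: arrow_rank_le orb cg cg'.
have [[_ ae ae'] [_ eg e'g]] := cg.
pose pc : chart R (X * X)%type (d + d) := prod_chart e e'.
pose img (b : set G) : set 'rV[R]_(d + d) := (cmap pc \o st) @` (b `&` st @^-1` cdom pc).
have thin (y : G) : cdom pc (st y) ->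
    exists N, [/\ nbhs y N & (closure (img N))° = set0].
  move=> [/= ey e'y]; have [cy acy cyy] := atlas_cover y.
  pose f := local_rep cy pc st; pose U := rep_dom cy pc st.
  have fC : smooth U f by exact: smooth_src_tgt.
  have Uo : open U by exact: (open_rep_dom (d := pc) src_tgt_continuous).
  have Uy : U (cmap cy y) by exists y.
  have fr u : U u -> \rank (Jac f u) = r.
    move=> [z [cz [/= ez e'z]] <-].
    have cat : charts_at cy e e' z by [].
    by rewrite -(rE _ _ _ _ cat); exact: rank_src_tgt.
  have [P [Po Py PU Pthin]] := constant_rank_nowhere_dense Uo Uy fC fr rlt.
  exists (cdom cy `&` cmap cy @^-1` P); split.
    have nd : nbhs y (cdom cy) by apply: open_nbhs_nbhs; split => //; exact: cdom_open.
    have nO : nbhs (cmap cy y) P := open_nbhs_nbhs (conj Po Py).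
    exact: filterI nd (cmap_continuous (mem_set cyy) nO).
  apply/seteqP; split => //; rewrite -Pthin; apply/interiorS/closureS.
  move=> _ [z [[cz Pz] _] <-]; exists (cmap cy z) => //.
  by rewrite /f /local_rep /= cmapK ?inE.
have [B cB [Bo Bb]] := manifold_second_countable G.
have [u uB] := enum_countable cB.
(* Only the basic open sets with nowhere dense image are kept; those contained
   in a neighbourhood provided by thin already cover the arrows. *)
pose S i : set 'rV[R]_(d + d) :=
  [set v | (closure (img (u i)))° = set0 /\ img (u i) v].
apply: (@no_countable_nowhere_dense_cover R (d + d) S (cmap pc @` cdom pc)).
- exact: cimg_open.
- by exists (cmap pc (st g)), (st g).
- move=> i; apply/seteqP; split => //.
  have [h|h] := pselect ((closure (img (u i)))° = set0).
    by rewrite -h; apply/interiorS/closureS => v [].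
  have -> : S i = set0 by apply/seteqP; split => // v [].
  by rewrite closure0 interior0.
move=> _ [xy pxy <-]; have [y _ yE] := orb xy I.
have py : cdom pc (st y) by rewrite /st yE.
have [N [nN Nthin]] := thin y py.
have [b [Bb' by_] bN] := Bb y N nN.
have [i ui] := uB b Bb'.
exists i => //; rewrite /S /= ui; split; last by exists y; [split|exact: (congr1 (cmap pc) yE)].
apply/seteqP; split => //; rewrite -Nthin; apply/interiorS/closureS.
by move=> _ [z [bz pz] <-]; exists z => //; split => //; exact: bN.
Qed.

End SourceTarget.

Theorem propositionA3 (R : realType) (L : lie_groupoid R) :
  one_orbit L -> transitive_lie_groupoid L.
Proof.
move=> orb; split => //; split; first exact: src_tgt_smooth_map.
move=> c _ ac [e [e' [ae ae' ->]]] g cg [/= eg e'g] w _.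
have cat : charts_at c e e' g by [].
have full : row_full (Jac (local_rep c (prod_chart e e') (src_tgt L)) (cmap c g)).
  by rewrite /row_full (rank_src_tgt cat) (arrow_rank_full orb cat).
have /submxP[v vE] := submx_full w full.
by exists v => //; rewrite diffJ -vE.
Qed.
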